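(* Let $\Theta$ be the $\mathfrak{spin}(7)$-invariant four-form on $V=\mathbb{R}^8$. The duality operator $b_\Theta:\Lambda^4V\to\Lambda^4V$ with $(b_\Theta)_{i_1i_2i_3i_4}{}^{j_1j_2j_3j_4}=\Theta_{[i_1i_2}{}^{[j_1j_2}\delta^{j_3j_4]}_{i_3i_4]}$ is a perfect duality operator of order four. The eigenspaces of $b_\Theta$ and the irreducible representations of $\Lambda^4V$ with respect to $\mathfrak{spin}(7)$ correspond in the following way: $$\Lambda^4_{(0)}V=\mathbf{35},\qquad \Lambda^4_{(-4)}V=\mathbf{1},\qquad \Lambda^4_{(-2)}V=\mathbf{7},\qquad \Lambda^4_{(\frac23)}V=\mathbf{27}.$$ The minimal polynomial of $b_\Theta$ is consequently $$\beta(\beta+2)(\beta+4)(\beta-\tfrac23)=\beta^4+\tfrac{16}{3}\beta^3+4\beta^2-\tfrac{16}{3}\beta .$$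
   Context: $V=\mathbb{R}^8$ is Euclidean with oriented orthonormal basis $e_1,\ldots,e_8$; indices are raised with the metric, repeated indices are summed, square brackets denote weight-one antisymmetrization, and $\delta^{ab}_{cd}=\delta^{[a}_c\delta^{b]}_d$. $\Theta\in\Lambda^4\mathbb{R}^8$ has totally antisymmetric components determined by $\Theta_{ijkl}=1$ for $(ijkl)=(1245),(1276),(1346),(1357),(2356),(2437),(4567),(1238),(4358),(4718),(5168),(5728),(6248),(6738)$, all components with index sets not listed being zero. $\mathfrak{spin}(7)\subset\mathfrak{so}(8)$ is the stabilizer of $\Theta$. On $F\in\Lambda^4V$ the operator is $b_\Theta(F)_{ijkl}=\Theta^{mn}{}_{[ij}F_{kl]mn}$. $\Lambda^4_{(\beta)}V$ is the eigenspace of $b_\Theta$ for the eigenvalue $\beta$. Under $\mathfrak{spin}(7)$, $\Lambda^4V$ decomposes into irreducible submodules of dimensions $1,7,27,35$, denoted $\mathbf{1},\mathbf{7},\mathbf{27},\mathbf{35}$. A duality operator has order $N$ if it has exactly $N$ distinct eigenvalues; for a form invariant under $\mathfrak h\subset\mathfrak{so}(V)$ it is called perfect on $\Lambda^kV$ if its order equals the number of irreducible $\mathfrak h$-submodules in the decomposition of $\Lambda^kV$ (here $\mathfrak h=\mathfrak{spin}(7)$). *)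

(* Defs.v *)
From HB Require Import structures.
From mathcomp Require Export all_boot all_order all_fingroup all_algebra.
From mathcomp Require Export reals.

Set Implicit Arguments.
Unset Strict Implicit.
Unset Printing Implicit Defensive.

Import GRing.Theory.
Local Open Scope ring_scope.

(* A rank-k tensor on R^n is given by its components in the standard           *)
(* orthonormal basis, so upper and lower indices need not be distinguished.    *)
(* The a-th basis vector e_a (a = 1, ..., n) has index a - 1 in 'I_n.          *)
Notation tensor R n k := {ffun k.-tuple 'I_n -> R^o}.

Definition perm_idx n k (s : 'S_k) (i : k.-tuple 'I_n) : k.-tuple 'I_n :=
  [tuple tnth i (s p) | p < k].

Definition subst_idx n k (p : 'I_k) (m : 'I_n) (i : k.-tuple 'I_n) :
    k.-tuple 'I_n :=
  [tuple if q == p then m else tnth i q | q < k].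

Section Tensors.
Variables (R : fieldType) (n k : nat).

Definition perm_tensor (s : 'S_k) (F : tensor R n k) : tensor R n k :=
  [ffun i => F (perm_idx s i)].

Lemma perm_tensor_is_linear s : linear (perm_tensor s).
Proof. by move=> a F G; apply/ffunP=> i; rewrite !ffunE. Qed.

HB.instance Definition _ s := GRing.isSemilinear.Build R _ _ _ (perm_tensor s)
  (GRing.semilinear_linear (perm_tensor_is_linear s)).

Definition alt_space : {vspace tensor R n k} :=
  (\bigcap_(s : 'S_k) lker (linfun (perm_tensor s) - (-1) ^+ s *: \1%VF))%VS.

Lemma alt_spaceP (F : tensor R n k) :
  reflect (forall (s : 'S_k) i, F (perm_idx s i) = (-1) ^+ s * F i)
          (F \in alt_space).
Proof.
rewrite memvE; apply: (iffP subv_bigcapP) => [FA s i | FA s _].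
  have := FA s isT; rewrite -memvE memv_ker !lfunE /= opp_lfunE !lfunE /=.
  by rewrite lfunE subr_eq0 => /eqP/ffunP/(_ i); rewrite !ffunE.
rewrite -memvE memv_ker !lfunE /= opp_lfunE !lfunE /= lfunE subr_eq0.
by apply/eqP/ffunP=> i; rewrite !ffunE FA.
Qed.

Definition antisym (F : tensor R n k) : tensor R n k :=
  [ffun i => (k`!%:R)^-1 * \sum_(s : 'S_k) (-1) ^+ s * F (perm_idx s i)].

Lemma perm_idxM (s t : 'S_k) (i : k.-tuple 'I_n) :
  perm_idx s (perm_idx t i) = perm_idx (s * t)%g i.
Proof. by apply: eq_from_tnth => p; rewrite !tnth_mktuple permM. Qed.

Lemma antisym_alt F : antisym F \in alt_space.
Proof.
apply/alt_spaceP=> s i; rewrite !ffunE mulrCA; congr (_ * _).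
rewrite (reindex_inj (mulIg s^-1%g)) mulr_sumr; apply: eq_bigr => t _.
by rewrite perm_idxM mulgKV odd_permM odd_permV signr_addb mulrAC mulrC mulrA.
Qed.

(* The derivation extending the endomorphism v |-> A v of R^n. *)
Definition tensor_act (A : 'M[R]_n) (F : tensor R n k) : tensor R n k :=
  [ffun i => \sum_(p < k) \sum_(m < n) A (tnth i p) m * F (subst_idx p m i)].

Lemma tensor_act_is_linear A : linear (tensor_act A).
Proof.
move=> a F G; apply/ffunP=> i; rewrite !ffunE scaler_sumr -big_split.
apply: eq_bigr => p _; rewrite scaler_sumr -big_split.
by apply: eq_bigr => m _; rewrite !ffunE mulrDr; congr (_ + _); apply: mulrCA.
Qed.

HB.instance Definition _ A := GRing.isSemilinear.Build R _ _ _ (tensor_act A)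
  (GRing.semilinear_linear (tensor_act_is_linear A)).

Lemma tensor_act_alt A F : F \in alt_space -> tensor_act A F \in alt_space.
Proof.
move=> /alt_spaceP FA; apply/alt_spaceP=> s i; rewrite !ffunE mulr_sumr.
rewrite [RHS](reindex_inj (@perm_inj _ s)); apply: eq_bigr => p _.
rewrite mulr_sumr; apply: eq_bigr => m _; rewrite mulrCA -FA tnth_mktuple.
congr (_ * F _); apply: eq_from_tnth => q.
by rewrite !tnth_mktuple (inj_eq (@perm_inj _ s)).
Qed.

End Tensors.

Notation Lambda R n k := (subvs_of (alt_space R n k)).

Section Modules.
Variables (R : fieldType) (n k : nat).

Definition form_act (A : 'M[R]_n) : 'End(Lambda R n k) :=
  linfun (vsproj (alt_space R n k) \o @tensor_act R n k A \o vsval).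

Lemma form_actE A (F : Lambda R n k) :
  vsval (form_act A F) = tensor_act A (vsval F).
Proof. by rewrite lfunE /= vsprojK // tensor_act_alt // subvsP. Qed.

Definition so : {pred 'M[R]_n} := [pred A | A^T == - A].

Definition stabilizer (Theta : tensor R n k) : {pred 'M[R]_n} :=
  [pred A | (A \in so) && (tensor_act A Theta == 0)].

Implicit Types (h : {pred 'M[R]_n}) (U W : {vspace Lambda R n k}).

Definition submodule h U : Prop :=
  forall A, A \in h -> forall F, F \in U -> form_act A F \in U.

Definition irreducible h U : Prop :=
  [/\ submodule h U, U != 0%VS
    & forall W, submodule h W -> (W <= U)%VS -> W = 0%VS \/ W = U].

Definition decomposition h N (Us : 'I_N -> {vspace Lambda R n k}) : Prop :=
  [/\ forall j, irreducible h (Us j),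
      directv (\sum_(j < N) Us j)
    & (\sum_(j < N) Us j)%VS = fullv].

(* U is "the" irreducible submodule of dimension d, which makes sense of       *)
(* denoting it by its dimension alone.                                         *)
Definition the_irreducible h (d : nat) U : Prop :=
  [/\ irreducible h U, \dim U = d
    & forall W, irreducible h W -> \dim W = d -> W = U].

End Modules.

Section Endomorphisms.
Variables (R : fieldType) (vT : vectType R).
Implicit Types (f : 'End(vT)) (p q : {poly R}).

Definition has_order f (N : nat) : Prop :=
  exists s : seq R,
    [/\ uniq s, size s = N & forall a, passmx.leigenvalue f a = (a \in s)].

(* End(vT) has no canonical ring structure, hence the iterates. *)
Definition annihilates p f : Prop :=
  forall v, \sum_(i < size p) p`_i *: iter i f v = 0.

Definition is_minimal_poly f p : Prop :=
  [/\ p \is monic, annihilates p f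
    & forall q, q != 0 -> annihilates q f -> (size p <= size q)%N].

End Endomorphisms.

Section Duality.
Variables (R : fieldType) (n : nat).
Implicit Types (Theta F : tensor R n 4) (i j : 4.-tuple 'I_n).

(* Theta^{mr}_{[i_0 i_1} F_{i_2 i_3] m r} *)
Definition duality_tensor Theta F : tensor R n 4 :=
  antisym [ffun i : 4.-tuple 'I_n =>
    \sum_(m < n) \sum_(r < n)
      Theta [tuple m; r; tnth i 0; tnth i 1] *
      F [tuple tnth i 2; tnth i 3; m; r]].

Lemma duality_tensor_is_linear Theta : linear (duality_tensor Theta).
Proof.
move=> a F G; apply/ffunP=> i; rewrite !ffunE.
rewrite [X in _ = X + _]mulrCA -[RHS]mulrDr; congr (_ * _).
rewrite mulr_sumr -big_split; apply: eq_bigr => s _; rewrite !ffunE mulrCA.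
rewrite -[RHS]mulrDr; congr (_ * _).
rewrite mulr_sumr -big_split; apply: eq_bigr => m _.
rewrite mulr_sumr -big_split; apply: eq_bigr => r _.
by rewrite !ffunE mulrDr; congr (_ + _); apply: mulrCA.
Qed.

HB.instance Definition _ Theta :=
  GRing.isSemilinear.Build R _ _ _ (duality_tensor Theta)
    (GRing.semilinear_linear (duality_tensor_is_linear Theta)).

Definition duality_op Theta : 'End(Lambda R n 4) :=
  linfun (vsproj (alt_space R n 4) \o duality_tensor Theta \o vsval).

Lemma duality_opE Theta (F : Lambda R n 4) :
  vsval (duality_op Theta F) = duality_tensor Theta (vsval F).
Proof. by rewrite lfunE /= vsprojK // antisym_alt. Qed.

(* delta^{ab}_{cd} = delta^{[a}_c delta^{b]}_d, with weight one. *)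
Definition delta2 (a b c d : 'I_n) : R :=
  2^-1 * (((a == c) && (b == d))%:R - ((a == d) && (b == c))%:R).

(* Theta_{[i_0 i_1}^{[j_0 j_1} delta^{j_2 j_3]}_{i_2 i_3]} *)
Definition duality_coef Theta i j : R :=
  antisym [ffun i' : 4.-tuple 'I_n =>
    antisym [ffun j' : 4.-tuple 'I_n =>
      Theta [tuple tnth i' 0; tnth i' 1; tnth j' 0; tnth j' 1] *
      delta2 (tnth j' 2) (tnth j' 3) (tnth i' 2) (tnth i' 3)] j] i.

(* The number of irreducible summands does not depend on the decomposition.    *)
Definition perfect (h : {pred 'M[R]_n}) Theta : Prop :=
  [/\ {subset h <= @so R n},
      forall A, A \in h -> tensor_act A Theta = 0
    & exists N, has_order (duality_op Theta) N /\
        exists Us : 'I_N -> {vspace Lambda R n 4}, decomposition h Us].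

End Duality.

Section Spin7.
Variable R : fieldType.

Definition Theta_quads : seq (seq nat) :=
  [:: [:: 1; 2; 4; 5]; [:: 1; 2; 7; 6]; [:: 1; 3; 4; 6]; [:: 1; 3; 5; 7];
      [:: 2; 3; 5; 6]; [:: 2; 4; 3; 7]; [:: 4; 5; 6; 7]; [:: 1; 2; 3; 8];
      [:: 4; 3; 5; 8]; [:: 4; 7; 1; 8]; [:: 5; 1; 6; 8]; [:: 5; 7; 2; 8];
      [:: 6; 2; 4; 8]; [:: 6; 7; 3; 8]]%N.

Definition Theta : tensor R 8 4 :=
  [ffun i => \sum_(q <- Theta_quads) \sum_(s : 'S_4)
     (-1) ^+ s * ([seq (nat_of_ord x).+1 | x <- perm_idx s i] == q)%:R].

Lemma Theta_alt : Theta \in alt_space R 8 4.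
Proof.
apply/alt_spaceP=> s i; rewrite !ffunE mulr_sumr; apply: eq_bigr => q _.
rewrite (reindex_inj (mulIg s^-1%g)) mulr_sumr; apply: eq_bigr => t _.
by rewrite perm_idxM mulgKV odd_permM odd_permV signr_addb mulrAC mulrC mulrA.
Qed.

Definition spin7 : {pred 'M[R]_8} := stabilizer Theta.

Definition b_Theta : 'End(Lambda R 8 4) := duality_op Theta.

End Spin7.

Arguments spin7 : clear implicits.

(* Main.v *)
(* The seven skew matrices gamma_a with Theta = - sum_a gamma_a /\ gamma_a satisfy
   the Clifford relations, so so(7) acts through the products gamma_x gamma_y,
   which stabilize Theta. For a subset T of {0, ..., 6} let gamma_T be the ordered
   product of its gamma_a. The forms gamma_T . Theta with #|T| = 0, 1, 3 span
   modules isomorphic to the exterior powers of degree 0, 1, 3 of R^7, and the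
   forms sum_ab S_ab gamma_a /\ gamma_b with S symmetric and traceless span the
   fourth one. In each of the first three, a polynomial in the rotation of the
   plane (x, y) acts on gamma_T . Theta by a nonzero constant or by 0, according to
   whether exactly one of x, y lies in T or not. Composing these operators over
   x in T, y not in T isolates T, so every nonzero submodule contains some
   gamma_T . Theta, hence all of them by rotating indices; the off-diagonal
   S = e_ab + e_ba play the same role with #|T| = 2 in the fourth module. Since
   b_Theta commutes with spin(7), its eigenvalue on each module is read off a
   single vector, and 35 + 1 + 7 + 27 = 70 leaves room for nothing else. *)

From HB Require Import structures.
Require Import Defs.
From mathcomp Require Import ring.

Set Implicit Arguments.
Unset Strict Implicit.
Unset Printing Implicit Defensive.

Import GRing.Theory Num.Theory.
Local Open Scope ring_scope.

(** * Action of matrices on tensors *)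

Section TensorTheory.
Variables (R : fieldType) (n k : nat).
Implicit Types (A B : 'M[R]_n) (F G : tensor R n k) (i : k.-tuple 'I_n).

Lemma tensor_actZl a A F : tensor_act (a *: A) F = a *: tensor_act A F.
Proof.
apply/ffunP=> i; rewrite !ffunE scaler_sumr; apply: eq_bigr => p _.
by rewrite scaler_sumr; apply: eq_bigr => m _; rewrite mxE -mulrA.
Qed.

Lemma subst_idxC p q m r i : p != q ->
  subst_idx q r (subst_idx p m i) = subst_idx p m (subst_idx q r i).
Proof.
move=> pq; apply: eq_from_tnth => x; rewrite !tnth_mktuple.
by case: eqP => // ->; rewrite eq_sym (negPf pq).
Qed.

Lemma subst_idx_id p m r i : subst_idx p r (subst_idx p m i) = subst_idx p r i.
Proof. by apply: eq_from_tnth => x; rewrite !tnth_mktuple; case: eqP. Qed.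

Lemma tnth_subst_idx p q m i :
  tnth (subst_idx p m i) q = if q == p then m else tnth i q.
Proof. by rewrite tnth_mktuple. Qed.

(* Substitutions in distinct slots commute, so only the terms in which A and B *)
(* act on the same slot survive in the commutator.                             *)
Lemma tensor_act_comm A B F :
  tensor_act A (tensor_act B F) - tensor_act B (tensor_act A F)
  = tensor_act (A *m B - B *m A) F.
Proof.
apply/ffunP=> i.
pose T A B p q := \sum_m \sum_r A (tnth i p) m *
  (B (tnth (subst_idx p m i) q) r * F (subst_idx q r (subst_idx p m i))).
have actE C D : tensor_act C (tensor_act D F) i = \sum_p \sum_q T C D p q.
  rewrite ffunE; apply: eq_bigr => p _; rewrite exchange_big /=.
  apply: eq_bigr => m _; rewrite ffunE mulr_sumr; apply: eq_bigr => q _.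
  by rewrite mulr_sumr.
have TC p q : p != q -> T A B p q = T B A q p.
  move=> pq; rewrite /T exchange_big; apply: eq_bigr => m _.
  apply: eq_bigr => r _; rewrite !tnth_subst_idx eq_sym (negPf pq).
  by rewrite subst_idxC // mulrCA.
have Tdiag C D p : T C D p p
    = \sum_r (C *m D) (tnth i p) r * F (subst_idx p r i).
  rewrite /T exchange_big; apply: eq_bigr => r _; rewrite mxE mulr_suml.
  by apply: eq_bigr => m _; rewrite tnth_subst_idx eqxx subst_idx_id mulrA.
rewrite [LHS]ffunE [X in _ + X]ffunE !actE [X in _ - X]exchange_big -sumrB ffunE.
apply: eq_bigr => p _; rewrite -sumrB (bigD1 p) //= [X in _ + X]big1 => [|q qp].
  by rewrite addr0 !Tdiag -sumrB; apply: eq_bigr => r _; rewrite !mxE mulrBl.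
by rewrite TC 1?eq_sym // subrr.
Qed.

Lemma antisym_is_linear : linear (@antisym R n k).
Proof.
move=> a F G; apply/ffunP=> i; rewrite !ffunE.
rewrite [X in _ = X + _]mulrCA -[RHS]mulrDr; congr (_ * _).
rewrite mulr_sumr -big_split; apply: eq_bigr => s _; rewrite !ffunE mulrCA.
by rewrite -[RHS]mulrDr.
Qed.

HB.instance Definition _ := GRing.isSemilinear.Build R _ _ _ (@antisym R n k)
  (GRing.semilinear_linear antisym_is_linear).

(** [A] acts in the same way on every slot, so permuting the slots only reorders the sum over
    slots. *)
Lemma tensor_act_antisym A F : tensor_act A (antisym F) = antisym (tensor_act A F).
Proof.
apply/ffunP=> i; rewrite !ffunE.
under eq_bigr => p _ do under eq_bigr => m _ do rewrite ffunE mulrCA mulr_sumr.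
under eq_bigr => p _ do rewrite -mulr_sumr exchange_big /=.
rewrite -mulr_sumr exchange_big /=; congr (_ * _); apply: eq_bigr => s _.
rewrite (reindex_inj (@perm_inj _ s)) /= ffunE mulr_sumr; apply: eq_bigr => p _.
rewrite mulr_sumr; apply: eq_bigr => m _; rewrite mulrCA tnth_mktuple.
congr (_ * (_ * F _)); apply: eq_from_tnth => q.
by rewrite !tnth_mktuple (inj_eq (@perm_inj _ s)).
Qed.

Lemma antisym_id F : k`!%:R != 0 :> R -> F \in alt_space R n k -> antisym F = F.
Proof.
move=> k0 /alt_spaceP FA; apply/ffunP=> i; rewrite ffunE.
under eq_bigr => s _ do rewrite FA mulrA -signr_addb addbb mul1r.
by rewrite sumr_const card_Sn -[F i *+ _]mulr_natl mulrA mulVf // mul1r.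
Qed.

(** Moving [s] from one factor to the other turns it into its inverse, which has the same sign. *)
Lemma antisym_adj F G : \sum_i antisym F i * G i = \sum_i F i * antisym G i.
Proof.
under eq_bigr => i _ do rewrite ffunE -mulrA mulr_suml.
under [RHS]eq_bigr => i _ do rewrite ffunE mulrCA mulr_sumr.
rewrite -!mulr_sumr exchange_big [in RHS]exchange_big /=; congr (_ * _).
rewrite (reindex_inj invg_inj); apply: eq_bigr => s _ /=.
have perm_idxK (t : 'S_k) : cancel (@perm_idx n k t) (perm_idx t^-1%g).
  by move=> i; rewrite perm_idxM mulVg; apply: eq_from_tnth => p; rewrite tnth_mktuple perm1.
rewrite (reindex_inj (can_inj (perm_idxK s))) /=; apply: eq_bigr => i _.
by rewrite perm_idxK odd_permV -mulrA mulrCA.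
Qed.

End TensorTheory.

(** * Alternating tensors and increasing indices *)

Section Sorted.
Variables (R : fieldType) (n k : nat).
Hypothesis two_neq0 : 2 != 0 :> R.

Definition increasing (i : k.-tuple 'I_n) := sorted ltn (map val i).

(** Exchanging two equal entries fixes the index and changes the sign, so twice the value is 0. *)
Lemma alt_eq0 (F : tensor R n k) (i : k.-tuple 'I_n) :
  F \in alt_space R n k -> ~~ uniq i -> F i = 0.
Proof.
move=> /alt_spaceP FA i_nuniq.
have /injectivePn[p [q pq ipq]] : ~~ injectiveb (tnth i).
  by rewrite /injectiveb /dinjectiveb -map_tnth_enum in i_nuniq *.
have := FA (tperm p q) i; rewrite odd_tperm pq expr1 mulN1r.
have -> : perm_idx (tperm p q) i = i.
  by apply: eq_from_tnth => r; rewrite tnth_mktuple; case: tpermP => // ->.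
move=> /eqP; rewrite -addr_eq0 -mulr2n -mulr_natl mulf_eq0 (negPf two_neq0).
by move=> /eqP.
Qed.

(** An index without repetition is a permutation of its sorted version; at all others both tensors
    vanish. *)
Lemma alt_ext (F G : tensor R n k) :
  F \in alt_space R n k -> G \in alt_space R n k ->
  (forall i, increasing i -> F i = G i) -> F = G.
Proof.
move=> FA GA FG; apply/ffunP=> i.
have [i_uniq|i_nuniq] := boolP (uniq i); last by rewrite !alt_eq0.
pose j := sort_tuple (relpre val leq) i.
have j_incr : increasing j.
  rewrite /increasing ltn_sorted_uniq_leq map_inj_uniq ?sort_uniq ?i_uniq /=.
    rewrite sorted_map; apply: sort_sorted => x y; exact: leq_total.
  exact: val_inj.
have /tuple_permP[s def_i] : perm_eq i j by rewrite perm_sym perm_sort.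
have -> : i = perm_idx s j by apply: val_inj.
by move/alt_spaceP: FA => ->; move/alt_spaceP: GA => ->; rewrite FG.
Qed.

(** Restriction to the increasing indices is injective on alternating tensors. For four-forms on
    R^8, the modules constructed below give the reverse inequality. *)
Lemma dim_alt_space_le : (\dim (alt_space R n k) <= 'C(n, k))%N.
Proof.
pose I := {i : k.-tuple 'I_n | increasing i}.
pose res (F : tensor R n k) : {ffun I -> R^o} := [ffun i => F (val i)].
have res_lin : linear res by move=> a F G; apply/ffunP=> i; rewrite !ffunE.
pose resL := GRing.isSemilinear.Build R _ _ _ res (GRing.semilinear_linear res_lin).
pose f := linfun (HB.pack_for {linear tensor R n k -> {ffun I -> R^o}} res resL).
have /limg_dim_eq <- : (alt_space R n k :&: lker f)%VS = 0%VS.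
  apply/eqP; rewrite -subv0; apply/subvP => F; rewrite memv_cap memv_ker lfunE /=.
  case/andP=> FA /eqP/ffunP f0; rewrite memv0; apply/eqP; apply: alt_ext => //.
    exact: mem0v.
  by move=> i i_incr; have := f0 (exist _ i i_incr); rewrite !ffunE.
apply: leq_trans (dimvS (subvf _)) _; rewrite dimvf.
rewrite /dim /= muln1 card_sig -card_ltn_sorted_tuples cardsE.
by [].
Qed.

End Sorted.

(** * Four-tensors: products of two-forms and equivariance of the duality operator *)

Section FourTensors.
Variables (R : fieldType) (n : nat).
Implicit Types (A M N : 'M[R]_n) (F G Theta : tensor R n 4).

Lemma sum_ord4 (V : nmodType) (f : 'I_4 -> V) :
  \sum_p f p = f 0 + f 1 + f 2 + f 3.
Proof.
rewrite !big_ord_recl big_ord0 addr0 !addrA.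
by congr (_ + f _ + f _ + f _); apply: val_inj.
Qed.

Lemma tuple4_eta (T : Type) (i : 4.-tuple T) :
  i = [tuple tnth i 0; tnth i 1; tnth i 2; tnth i 3].
Proof. by apply: eq_from_tnth => -[[|[|[|[|//]]]]] ?; congr tnth; apply: val_inj. Qed.

Lemma tensor_act4 A F (a b c d : 'I_n) : tensor_act A F [tuple a; b; c; d] =
    \sum_s A a s * F [tuple s; b; c; d] + \sum_s A b s * F [tuple a; s; c; d]
  + \sum_s A c s * F [tuple a; b; s; d] + \sum_s A d s * F [tuple a; b; c; s].
Proof.
rewrite ffunE sum_ord4; congr (_ + _ + _ + _); apply: eq_bigr => s _;
  congr (_ * F _); apply: eq_from_tnth => -[[|[|[|[|//]]]]] ?;
  by rewrite tnth_mktuple.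
Qed.

(** For skew [M] and [N] this is their exterior product, up to the factor due to weight-one
    antisymmetrization. *)
Definition wedge2 M N : tensor R n 4 :=
  antisym [ffun i : 4.-tuple 'I_n =>
    M (tnth i 0) (tnth i 1) * N (tnth i 2) (tnth i 3)].

Lemma wedge2Dl M M' N : wedge2 (M + M') N = wedge2 M N + wedge2 M' N.
Proof.
rewrite -linearD; congr antisym; apply/ffunP=> i.
by rewrite !ffunE mxE mulrDl.
Qed.

Lemma wedge2Zl a M N : wedge2 (a *: M) N = a *: wedge2 M N.
Proof.
rewrite -linearZ; congr antisym; apply/ffunP=> i.
by rewrite !ffunE mxE -mulrA.
Qed.

Lemma wedge2Dr M N N' : wedge2 M (N + N') = wedge2 M N + wedge2 M N'.
Proof.
rewrite -linearD; congr antisym; apply/ffunP=> i.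
by rewrite !ffunE mxE mulrDr.
Qed.

Lemma wedge2Zr a M N : wedge2 M (a *: N) = a *: wedge2 M N.
Proof.
rewrite -linearZ; congr antisym; apply/ffunP=> i.
by rewrite !ffunE mxE mulrCA.
Qed.

(** Exchanging the two halves of the index is an even permutation. *)
Lemma wedge2C M N : wedge2 M N = wedge2 N M.
Proof.
pose s : 'S_4 := (tperm 0%R 2%R * tperm 1%R 3%R)%g.
have [s0 s1 s2 s3] : [/\ s 0 = 2, s 1 = 3, s 2 = 0 & s 3 = 1].
  by split; rewrite permM !permE.
apply/ffunP=> i; rewrite !ffunE; congr (_ * _).
rewrite (reindex_inj (mulgI s)); apply: eq_bigr => t _.
rewrite odd_permM odd_permM !odd_tperm !ffunE mulrC -perm_idxM.
rewrite !(tnth_mktuple _ (_ : 'I_4)) s0 s1 s2 s3 [LHS]mulrC.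
by congr (_ * _); rewrite mulrC.
Qed.

(** On a two-tensor [M] the derivation is A M + M A^T, one term for each index; the Leibniz rule
    gives the rest. *)
Lemma tensor_act_wedge2 A M N : tensor_act A (wedge2 M N)
  = wedge2 (A *m M + M *m A^T) N + wedge2 M (A *m N + N *m A^T).
Proof.
rewrite tensor_act_antisym -linearD; congr antisym; apply/ffunP=> i.
rewrite [i]tuple4_eta tensor_act4 !ffunE !mxE mulrDl mulrDr !mulr_suml !mulr_sumr.
rewrite !addrA; congr (_ + _ + _ + _); apply: eq_bigr => s _.
- by rewrite ffunE mulrA.
- by rewrite ffunE mxE mulrA [A _ _ * _]mulrC.
- by rewrite ffunE mulrCA.
- by rewrite ffunE mxE [N _ _ * _]mulrC mulrCA.
Qed.

(** A skew [A] preserves the metric, so its contributions on the two contracted indices cancel and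
    those on the free indices remain. *)
Lemma tensor_act_duality A Theta F : A \in @so R n ->
  tensor_act A (duality_tensor Theta F)
  = duality_tensor (tensor_act A Theta) F + duality_tensor Theta (tensor_act A F).
Proof.
move=> /eqP A_skew; rewrite tensor_act_antisym /duality_tensor -linearD.
congr antisym; apply/ffunP=> i.
have skew m r : A r m = - A m r by have /matrixP/(_ m r) := A_skew; rewrite !mxE.
(* Invariance of the Euclidean pairing of [f] and [g] under a skew matrix. *)
have cancel (f g : 'I_n -> R) :
  \sum_m (\sum_s A m s * f s) * g m + \sum_m f m * (\sum_s A m s * g s) = 0.
  under eq_bigr => m _ do rewrite mulr_suml.
  under [X in _ + X]eq_bigr => m _ do rewrite mulr_sumr.
  rewrite [X in _ + X]exchange_big -big_split big1 //= => m _.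
  rewrite -big_split big1 //= => s _; rewrite (skew m s); ring.
have pull e (g : 'I_n -> 'I_n -> 'I_n -> R) :
  \sum_s e s * (\sum_m \sum_r g s m r) = \sum_m \sum_r \sum_s e s * g s m r.
  under eq_bigr => s _ do rewrite mulr_sumr.
  rewrite exchange_big; apply: eq_bigr => m _.
  under eq_bigr => s _ do rewrite mulr_sumr.
  by rewrite exchange_big.
rewrite [i]tuple4_eta; move: (tnth i 0) (tnth i 1) (tnth i 2) (tnth i 3) => a b c d.
have split4 (x1 x2 x3 x4 : 'I_n -> 'I_n -> R) :
  \sum_m \sum_r (x1 m r + x2 m r + x3 m r + x4 m r)
  = \sum_m \sum_r x1 m r + \sum_m \sum_r x2 m r
    + \sum_m \sum_r x3 m r + \sum_m \sum_r x4 m r.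
  by rewrite -!big_split /=; apply: eq_bigr => m _; rewrite -!big_split.
pose th x y m r := Theta [tuple m; r; x; y].
pose f x y m r := F [tuple x; y; m; r].
rewrite tensor_act4 [RHS]ffunE.
have -> : [ffun i : 4.-tuple 'I_n => \sum_m \sum_r
    tensor_act A Theta [tuple m; r; tnth i 0; tnth i 1] *
    F [tuple tnth i 2; tnth i 3; m; r]] [tuple a; b; c; d] =
    \sum_m \sum_r (\sum_s A m s * th a b s r) * f c d m r
  + \sum_m \sum_r (\sum_s A r s * th a b m s) * f c d m r
  + \sum_m \sum_r \sum_s A a s * (th s b m r * f c d m r)
  + \sum_m \sum_r \sum_s A b s * (th a s m r * f c d m r).
  rewrite ffunE -split4; apply: eq_bigr => m _; apply: eq_bigr => r _.
  rewrite tensor_act4 !mulrDl; congr (_ + _ + _ + _);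
  by rewrite mulr_suml; apply: eq_bigr => s _; rewrite -mulrA.
have -> : [ffun i : 4.-tuple 'I_n => \sum_m \sum_r
    Theta [tuple m; r; tnth i 0; tnth i 1] *
    tensor_act A F [tuple tnth i 2; tnth i 3; m; r]] [tuple a; b; c; d] =
    \sum_m \sum_r \sum_s A c s * (th a b m r * f s d m r)
  + \sum_m \sum_r \sum_s A d s * (th a b m r * f c s m r)
  + \sum_m \sum_r th a b m r * (\sum_s A m s * f c d s r)
  + \sum_m \sum_r th a b m r * (\sum_s A r s * f c d m s).
  rewrite ffunE -split4; apply: eq_bigr => m _; apply: eq_bigr => r _.
  rewrite tensor_act4 !mulrDr; congr (_ + _ + _ + _);
  by rewrite mulr_sumr; apply: eq_bigr => s _; rewrite mulrCA.
(* On a contracted index, [A] acting on [F] is the opposite of [A] acting on [Theta]. *)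
have cancel1 : \sum_m \sum_r th a b m r * (\sum_s A m s * f c d s r)
    = - \sum_m \sum_r (\sum_s A m s * th a b s r) * f c d m r.
  apply/eqP; rewrite -addr_eq0 exchange_big [X in _ + X]exchange_big.
  by rewrite -big_split big1 //= => r _; rewrite addrC cancel.
have cancel2 : \sum_m \sum_r th a b m r * (\sum_s A r s * f c d m s)
    = - \sum_m \sum_r (\sum_s A r s * th a b m s) * f c d m r.
  apply/eqP; rewrite -addr_eq0.
  by rewrite -big_split big1 //= => m _; rewrite addrC cancel.
rewrite cancel1 cancel2 -!pull.
have ctrE x y z t : [ffun i : 4.-tuple 'I_n => \sum_m \sum_r
    Theta [tuple m; r; tnth i 0; tnth i 1] *
    F [tuple tnth i 2; tnth i 3; m; r]] [tuple x; y; z; t]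
  = \sum_m \sum_r th x y m r * f z t m r by rewrite ffunE.
under [X in X + _ + _ + _ = _]eq_bigr do rewrite ctrE.
under [X in _ + X + _ + _ = _]eq_bigr do rewrite ctrE.
under [X in _ + X + _ = _]eq_bigr do rewrite ctrE.
under [X in _ + _ + X = _]eq_bigr do rewrite ctrE.
ring.
Qed.

Lemma sum_tuple_cons (V : nmodType) (T : finType) k (f : k.+1.-tuple T -> V) :
  \sum_t f t = \sum_x \sum_(t : k.-tuple T) f [tuple of x :: t].
Proof.
rewrite pair_big (reindex (fun p : T * k.-tuple T => [tuple of p.1 :: p.2])) //=.
exists (fun t : k.+1.-tuple T => (thead t, behead_tuple t)).
  by move=> [x t] _; congr pair; apply: val_inj.
by move=> t _; rewrite [t in RHS]tuple_eta.
Qed.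

Lemma sum_tuple4 (V : nmodType) (T : finType) (f : 4.-tuple T -> V) :
  \sum_t f t = \sum_a \sum_b \sum_c \sum_d f [tuple a; b; c; d].
Proof.
rewrite sum_tuple_cons; apply: eq_bigr => a _.
rewrite sum_tuple_cons; apply: eq_bigr => b _.
rewrite sum_tuple_cons; apply: eq_bigr => c _.
rewrite sum_tuple_cons; apply: eq_bigr => d _.
rewrite (big_pred1 [tuple]) => [|t]; last exact/esym/eqP/tuple0.
by congr f; apply: val_inj.
Qed.

Lemma alt_swap_halves F (a b c d : 'I_n) : F \in alt_space R n 4 ->
  F [tuple c; d; a; b] = F [tuple a; b; c; d].
Proof.
pose s : 'S_4 := (tperm 0%R 2%R * tperm 1%R 3%R)%g.
move=> /alt_spaceP/(_ s [tuple a; b; c; d]).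
rewrite odd_permM !odd_tperm mul1r => <-; congr (F _).
apply: eq_from_tnth => -[[|[|[|[|//]]]]] ?; by rewrite tnth_mktuple permM !permE.
Qed.

Lemma alt_swap_last F (a b c d : 'I_n) : F \in alt_space R n 4 ->
  F [tuple a; b; d; c] = - F [tuple a; b; c; d].
Proof.
move=> /alt_spaceP/(_ (tperm 2%R 3%R) [tuple a; b; c; d]).
rewrite odd_tperm mulN1r => <-; congr (F _).
apply: eq_from_tnth => -[[|[|[|[|//]]]]] ?; by rewrite tnth_mktuple !permE.
Qed.

(** By adjointness the antisymmetrization in [j] moves onto [F], which it fixes. Contracting with
    [delta2] then antisymmetrizes two indices of [F], again without effect, and the symmetry under
    exchange of index pairs reconciles the two orders of indices. *)
Lemma duality_tensorE Theta F (i : 4.-tuple 'I_n) : 2 != 0 :> R -> 4`!%:R != 0 :> R ->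
  Theta \in alt_space R n 4 -> F \in alt_space R n 4 ->
  duality_tensor Theta F i = \sum_j duality_coef Theta i j * F j.
Proof.
move=> two_neq0 fact4_neq0 ThetaA FA.
pose U (i' j : 4.-tuple 'I_n) := Theta [tuple tnth i' 0; tnth i' 1; tnth j 0; tnth j 1] *
      delta2 R (tnth j 2) (tnth j 3) (tnth i' 2) (tnth i' 3).
have contract i' : \sum_j U i' j * F j = \sum_(m < n) \sum_(r < n)
      Theta [tuple m; r; tnth i' 0; tnth i' 1] *
      F [tuple tnth i' 2; tnth i' 3; m; r].
  rewrite sum_tuple4; apply: eq_bigr => m _; apply: eq_bigr => r _.
  rewrite /U; under eq_bigr => x _ do under eq_bigr => y _ do
    rewrite ![tnth [tuple m; r; x; y] _]/=.
  move: (tnth i' 0) (tnth i' 1) (tnth i' 2) (tnth i' 3) => a b c d.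
  have pick (x0 y0 : 'I_n) (H : 'I_n -> 'I_n -> R) :
    \sum_x \sum_y ((x == x0) && (y == y0))%:R * H x y = H x0 y0.
    rewrite (bigD1 x0) //= [X in _ + X]big1 => [|x /negPf xx0]; last first.
      by rewrite big1 // => y _; rewrite xx0 mul0r.
    rewrite addr0 (bigD1 y0) //= !eqxx mul1r big1 ?addr0 // => y /negPf yy0.
    by rewrite yy0 mul0r.
  transitivity (Theta [tuple a; b; m; r] * (2^-1 *
    (F [tuple m; r; c; d] - F [tuple m; r; d; c]))); last first.
    rewrite (alt_swap_last m r c d) // [in LHS]alt_swap_halves //.
    by rewrite [in RHS]alt_swap_halves //; field.
  rewrite -(pick c d (fun x y => F [tuple m; r; x; y])).
  rewrite -(pick d c (fun x y => F [tuple m; r; x; y])) -sumrB !mulr_sumr.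
  apply: eq_bigr => x _; rewrite -sumrB !mulr_sumr; apply: eq_bigr => y _.
  by rewrite /delta2; ring.
rewrite /duality_tensor ffunE /duality_coef.
under [RHS]eq_bigr => j _ do rewrite ffunE -mulrA mulr_suml.
rewrite -mulr_sumr exchange_big /=; congr (_ * _); apply: eq_bigr => s _.
rewrite ffunE -contract.
transitivity ((-1) ^+ s * \sum_j antisym [ffun j => U (perm_idx s i) j] j * F j).
  rewrite antisym_adj antisym_id //; congr (_ * _).
  by apply: eq_bigr => j _; rewrite [in RHS]ffunE.
by rewrite mulr_sumr; apply: eq_bigr => j _; rewrite [in RHS]ffunE mulrA.
Qed.

End FourTensors.

(** * Eigenspaces and irreducible submodules *)

Section Spectral.
Variables (K : fieldType) (vT : vectType K) (f : 'End(vT)).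
Implicit Types (p q : {poly K}) (v : vT) (a : K).
Local Notation leigenspace := (passmx.leigenspace f).

Lemma leigenspaceP a v : reflect (f v = a *: v) (v \in leigenspace a).
Proof.
rewrite memv_ker !lfunE /= opp_lfunE scale_lfunE id_lfunE subr_eq0.
exact: eqP.
Qed.

(** The value p(f), packed as an endomorphism so that its kernel and images are available. *)
Definition lfun_poly p : 'End(vT) :=
  \sum_(i < size p) p`_i *: iter i (comp_lfun f) \1%VF.

Lemma lfun_polyE p v : lfun_poly p v = \sum_(i < size p) p`_i *: iter i f v.
Proof.
rewrite sum_lfunE; apply: eq_bigr => i _; rewrite scale_lfunE; congr (_ *: _).
by elim: (i : nat) => [|k IHk] /=; rewrite ?id_lfunE // comp_lfunE IHk.
Qed.

Lemma lfun_poly_eigen p a v : v \in leigenspace a -> lfun_poly p v = p.[a] *: v.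
Proof.
move=> /leigenspaceP fv; rewrite lfun_polyE horner_coef scaler_suml.
apply: eq_bigr => i _; rewrite -scalerA; congr (_ *: _).
by elim: (i : nat) => [|k IHk] /=; rewrite ?scale1r // IHk linearZ /= fv scalerA exprSr.
Qed.

Variables (N : nat) (a : 'I_N -> K).
Hypothesis a_inj : injective a.

(** A Lagrange polynomial without normalization: on the sum of the eigenspaces, its value at [f] is
    a nonzero multiple of the projection to the [j]-th one. *)
Definition eigen_poly (j : 'I_N) : {poly K} := \prod_(i | i != j) ('X - (a i)%:P).

Lemma eigen_poly_eq0 i j : ((eigen_poly j).[a i] == 0) = (i != j).
Proof.
rewrite horner_prod prodf_seq_eq0; apply/hasP/idP => [[l _ /andP[lj]]|ij].
  by rewrite hornerXsubC subr_eq0 => /eqP/a_inj ->.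
by exists i; rewrite ?mem_index_enum // ij hornerXsubC subrr eqxx.
Qed.

Lemma eigen_poly_sum j (u : 'I_N -> vT) : (forall i, u i \in leigenspace (a i)) ->
  lfun_poly (eigen_poly j) (\sum_i u i) = (eigen_poly j).[a j] *: u j.
Proof.
move=> uE; rewrite linear_sum (bigD1 j) //= big1 ?addr0; last move=> i ij.
  exact: lfun_poly_eigen.
rewrite (lfun_poly_eigen _ (uE i)).
by have := eigen_poly_eq0 i j; rewrite ij => /eqP ->; rewrite scale0r.
Qed.

Lemma directv_leigenspace : directv (\sum_j leigenspace (a j)).
Proof.
apply/directv_sum_independent => u uE u0 j _.
have := @eigen_poly_sum j u (fun i => uE i isT); rewrite u0 linear0 => /esym/eqP.
by rewrite scaler_eq0 eigen_poly_eq0 eqxx /= => /eqP.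
Qed.

(** The eigenspaces are independent, so their dimensions add up to at most that of the whole space,
    hence to at most that of the [U j] together. All inclusions are therefore equalities. *)
Lemma leigenspace_full (U : 'I_N -> {vspace vT}) :
    (forall j, (U j <= leigenspace (a j))%VS) -> (dim vT <= \sum_j \dim (U j))%N ->
  (forall j, leigenspace (a j) = U j) /\ (\sum_j leigenspace (a j))%VS = fullv.
Proof.
move=> UE dimU; have /directvP/= dimE := directv_leigenspace.
have dimUE j : (\dim (U j) <= \dim (leigenspace (a j)))%N by exact: dimvS.
have le_dim : (\sum_j \dim (leigenspace (a j)) <= \sum_j \dim (U j))%N.
  by apply: leq_trans dimU; rewrite -dimE -dimvf dimvS ?subvf.
split=> [j|]; last first.
  apply/eqP; rewrite eqEdim subvf /= dimvf dimE (leq_trans dimU) //.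
  by apply: leq_sum => j _.
apply/esym/eqP; rewrite eqEdim UE /=.
have le_rest : (\sum_(i | i != j) \dim (U i)
    <= \sum_(i | i != j) \dim (leigenspace (a i)))%N by apply: leq_sum.
move: le_dim; rewrite (bigD1 j) //= [leqRHS](bigD1 j) //= => le_dim.
by rewrite -(leq_add2r (\sum_(i | i != j) \dim (U i))) (leq_trans _ le_dim) ?leq_add2l.
Qed.

Hypothesis full : (\sum_j leigenspace (a j))%VS = fullv.
Hypothesis neq0 : forall j, leigenspace (a j) != 0%VS.

(** On each eigenspace p(f) is the scalar p(a j); the eigenspaces are nonzero and span. *)
Lemma lfun_poly_roots p : annihilates p f <-> forall j, root p (a j).
Proof.
split=> [p_f j|pa v].
  have := p_f (vpick (leigenspace (a j))); rewrite -lfun_polyE.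
  rewrite (lfun_poly_eigen _ (memv_pick _)) => /eqP.
  by rewrite scaler_eq0 vpick0 (negPf (neq0 j)) orbF.
rewrite -lfun_polyE; have: v \in (\sum_j leigenspace (a j))%VS by rewrite full memvf.
move=> /memv_sumP[u uE ->]; rewrite linear_sum big1 //= => j _.
by rewrite (lfun_poly_eigen _ (uE j isT)) (eqP (pa j)) scale0r.
Qed.

(** The product of the ['X - (a j)%:P] annihilates [f], so it vanishes at every eigenvalue. *)
Lemma leigenvalueE b : passmx.leigenvalue f b = (b \in codom a).
Proof.
apply/idP/codomP => [b_eig|[j ->]]; last exact: neq0.
pose p := \prod_j ('X - (a j)%:P).
have /lfun_poly_roots/(_ (vpick (leigenspace b))) : forall j, root p (a j).
  move=> j; rewrite /p /root horner_prod (bigD1 j) //= hornerXsubC subrr.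
  by rewrite mul0r.
rewrite -lfun_polyE (lfun_poly_eigen _ (memv_pick _)) => /eqP.
rewrite scaler_eq0 vpick0 (negPf b_eig) orbF horner_prod prodf_seq_eq0.
by case/hasP=> j _ /=; rewrite hornerXsubC subr_eq0 => /eqP ->; exists j.
Qed.

(** A nonzero annihilating polynomial has the [N] distinct roots [a j], hence degree at least
    [N]. *)
Lemma is_minimal_poly_prod : is_minimal_poly f (\prod_j ('X - (a j)%:P)).
Proof.
split.
- by apply: monic_prod => j _; apply: monicXsubC.
- apply/lfun_poly_roots => j; rewrite /root horner_prod (bigD1 j) //=.
  by rewrite hornerXsubC subrr mul0r.
- move=> q q_neq0 /lfun_poly_roots qa; rewrite size_prod_XsubC.
  rewrite -[index_enum _]enumT -(size_map a); apply: max_poly_roots => //; last exact/injectiveP.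
  by apply/allP => _ /codomP[j ->].
Qed.

End Spectral.

(** * Irreducible submodules when the eigenspaces are irreducible of distinct dimensions *)

Section IrreducibleEigenspaces.
Variables (R : fieldType) (n k : nat) (h : {pred 'M[R]_n}).
Variable f : 'End(Lambda R n k).
Hypothesis f_equiv : forall A, A \in h -> forall F, f (form_act k A F) = form_act k A (f F).
Variables (N : nat) (a : 'I_N -> R).
Hypothesis a_inj : injective a.
Local Notation E j := (passmx.leigenspace f (a j)).
Hypothesis full : (\sum_j E j)%VS = fullv.
Hypothesis irr : forall j, irreducible h (E j).
Hypothesis dim_inj : injective (fun j => \dim (E j)).

Lemma leigenspace_submodule b : submodule h (passmx.leigenspace f b).
Proof.
move=> A hA F /leigenspaceP fF; apply/leigenspaceP.
by rewrite f_equiv // fF linearZ.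
Qed.

Lemma lfun_poly_equiv p A F : A \in h ->
  lfun_poly f p (form_act k A F) = form_act k A (lfun_poly f p F).
Proof.
move=> hA; rewrite !lfun_polyE linear_sum; apply: eq_bigr => i _.
rewrite linearZ /=; congr (_ *: _).
by elim: (i : nat) => [|l IHl] //=; rewrite IHl f_equiv.
Qed.

(* Projecting W to the eigenspaces, each nonzero projection is injective on W *)
(* and onto an irreducible eigenspace; the dimensions leave room for one only. *)
Lemma irreducible_eigenspace W : irreducible h W -> exists j, W = E j.
Proof.
move=> [W_sub W_neq0 W_irr]; pose P j := lfun_poly f (eigen_poly a j).
have PE j v : P j v \in E j.
  have /memv_sumP[u uE ->] : v \in (\sum_j E j)%VS by rewrite full memvf.
  by rewrite eigen_poly_sum // ?memvZ ?uE // => i; apply: uE.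
have dimPW j : (P j @: W)%VS != 0%VS -> \dim W = \dim (E j).
  move=> PW_neq0; have [_ _ E_irr] := irr j.
  have PW_sub : submodule h (P j @: W)%VS.
    move=> A hA _ /memv_imgP[F FW ->]; rewrite -lfun_poly_equiv //.
    by rewrite memv_img // W_sub.
  have <- : (P j @: W)%VS = E j.
    have [|PW0|//] := E_irr _ PW_sub; last by rewrite PW0 eqxx in PW_neq0.
    by apply/subvP => _ /memv_imgP[F _ ->].
  rewrite limg_dim_eq //; have [||//|capW] := W_irr (W :&: lker (P j))%VS.
  - move=> A hA F; rewrite !memv_cap !memv_ker => /andP[FW /eqP PF].
    by rewrite W_sub //= [P j _]lfun_poly_equiv // -/(P j) PF linear0.
  - exact: capvSl.
  - by move: PW_neq0; rewrite -lkerE -capW capvSr.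
have [j PW_neq0] : exists j, (P j @: W)%VS != 0%VS.
  apply/existsP; apply: contraR W_neq0; rewrite negb_exists => /forallP PW0.
  rewrite -subv0; apply/subvP => v vW; rewrite memv0.
  have /memv_sumP[u uE def_v] : v \in (\sum_j E j)%VS by rewrite full memvf.
  rewrite def_v big1 // => j _; apply/eqP.
  have /eqP : P j v = 0.
    by apply/eqP; rewrite -memv0 -(eqP (negbNE (PW0 j))) memv_img.
  rewrite def_v eigen_poly_sum // => [|i]; last exact: uE.
  by rewrite scaler_eq0 eigen_poly_eq0 // eqxx.
exists j; have [_ _ E_irr] := irr j; suff WE : (W <= E j)%VS.
  by have [W0|//] := E_irr _ W_sub WE; rewrite W0 eqxx in W_neq0.
apply/subvP => v vW.
have /memv_sumP[u uE def_v] : v \in (\sum_j E j)%VS by rewrite full memvf.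
rewrite def_v (bigD1 j) //= big1 ?addr0 ?uE // => i ij; apply/eqP.
have /eqP : P i v = 0.
  apply/eqP; rewrite -memv0; suff /eqP <- : (P i @: W == 0)%VS by exact: memv_img.
  by apply: contraNT ij => /dimPW; rewrite (dimPW j) // => /dim_inj ->.
rewrite def_v eigen_poly_sum // => [|l]; last exact: uE.
by rewrite scaler_eq0 eigen_poly_eq0 // eqxx.
Qed.

Lemma the_irreducible_eigenspace j : the_irreducible h (\dim (E j)) (E j).
Proof.
split=> // W /irreducible_eigenspace[i ->] dimE.
by rewrite (dim_inj dimE).
Qed.

End IrreducibleEigenspaces.

(* Vectors v_T indexed by the subsets T of {0, ..., m - 1} on which operators   *)
(* K_xy exchange x in T against y outside T, and operators N_xy scale v_T by c  *)
(* if exactly one of x, y lies in T and kill it otherwise.                      *)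
Section ExchangeFamily.
Variables (F : fieldType) (vT : vectType F) (m k : nat).
Variables (K N : 'I_m -> 'I_m -> 'End(vT)) (v : {set 'I_m} -> vT) (c : F).
Hypothesis c_neq0 : c != 0.
Hypothesis k_neq : (k + k != m)%N.
Implicit Types (S T : {set 'I_m}) (W : {vspace vT}).

Definition cuts T x y := (x \in T) != (y \in T).

Hypothesis N_scale : forall x y T, x != y -> #|T| = k ->
  N x y (v T) = (if cuts T x y then c else 0) *: v T.
Hypothesis K_exchange : forall x y T, #|T| = k -> x \in T -> y \notin T ->
  exists2 d, d != 0 & K x y (v T) = d *: v (y |: T :\ x).

Definition stable W := forall x y, x != y -> forall u, u \in W ->
  K x y u \in W /\ N x y u \in W.

Definition family_span := (\sum_(T : {set 'I_m} | #|T| == k) <[v T]>)%VS.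

(** If some [x] in [S] lies in [T], nothing outside [S] does, and [T = S] by cardinality. Otherwise
    [T] is the complement of [S], which [k_neq] excludes. *)
Lemma eq_of_cuts S T : #|S| = k -> #|T| = k ->
  (forall x y, x \in S -> y \notin S -> cuts T x y) -> T = S.
Proof.
move=> Sk Tk cutT; have [/eqP|/set0Pn[x xS]] := boolP (S == set0).
  by move=> S0; rewrite S0 cards0 in Sk; rewrite S0; apply/eqP; rewrite -cards_eq0 Tk -Sk.
have [xT|xT] := boolP (x \in T).
  apply/eqP; rewrite eqEcard Tk Sk leqnn andbT; apply/subsetP => y; apply: contraLR => yS.
  by have := cutT x y xS yS; rewrite /cuts xT; case: (y \in T).
suff TS : T = ~: S by case/eqP: k_neq; rewrite -{1}Sk -Tk TS cardsC card_ord.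
apply/eqP; rewrite eq_sym eqEsubset; apply/andP; split; apply/subsetP => y.
  by rewrite inE => yS; have := cutT x y xS yS; rewrite /cuts (negPf xT); case: (y \in T).
(* A point [z] outside [S] is in [T] because the pair of [x] and [z] is cut; then [y] is not,
   because the pair of [y] and [z] is cut too. *)
rewrite inE; apply: contraL => yS; have [z zS] : exists z, z \notin S.
  apply/existsP; apply: contraR xT; rewrite negb_exists => /forallP ST.
  have SE : S = setT by apply/setP=> z; rewrite inE; apply/negbNE/ST.
  have -> : T = setT by apply/eqP; rewrite eqEcard subsetT Tk -Sk SE leqnn.
  by rewrite inE.
have := cutT x z xS zS; have := cutT y z yS zS; rewrite /cuts (negPf xT).
by case: (z \in T); case: (y \in T).
Qed.

(** Applying [N x y] for all [x] in [S] and [y] outside [S] multiplies the term of [T] by a power of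
    [c] if [T] cuts all these pairs and by 0 otherwise. Only the term of [S] survives. *)
Lemma mem_family_isolate W (u : {set 'I_m} -> vT) S : stable W -> #|S| = k ->
  (forall T, #|T| = k -> u T \in <[v T]>%VS) ->
  \sum_(T : {set 'I_m} | #|T| == k) u T \in W -> u S \in W.
Proof.
move=> W_stable Sk uv uW.
pose r := [seq (x, y) | x <- enum S, y <- enum (~: S)].
have rP x y : ((x, y) \in r) = (x \in S) && (y \notin S).
  apply/allpairsP/andP => [[[a b]] /= [aS bS [-> ->]]|[xS yS]].
    by move: aS bS; rewrite !mem_enum inE.
  by exists (x, y); rewrite !mem_enum inE.
have r_neq x y : (x, y) \in r -> x != y.
  by rewrite rP => /andP[xS]; apply: contraNneq => <-.
have N_line x y T w : x != y -> #|T| = k -> w \in <[v T]>%VS ->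
    N x y w = (if cuts T x y then c else 0) *: w.
  by move=> xy Tk /vlineP[d ->]; rewrite linearZ /= N_scale // !scalerA mulrC.
suff [d d_neq0 Wd] : exists2 d, d != 0 & d *: u S \in W.
  by rewrite -[u S](scalerK d_neq0) memvZ.
pose allcut r' (T : {set 'I_m}) := all (fun p => cuts T p.1 p.2) r'.
have [d d_neq0] : exists2 d, d != 0 &
    d *: \sum_(T : {set 'I_m} | (#|T| == k) && allcut r T) u T \in W.
  elim: (r) r_neq => [_|[x y] r' IHr r_neq].
    by exists 1; rewrite ?oner_neq0 // scale1r; under eq_bigl do rewrite andbT.
  have [|d d_neq0 Wd] := IHr.
    by move=> x' y' r'xy; apply: r_neq; rewrite inE r'xy orbT.
  have xy : x != y by apply: r_neq; rewrite mem_head.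
  exists (d * c); first by rewrite mulf_neq0.
  have [_] := W_stable x y xy _ Wd; rewrite linearZ linear_sum /= -scalerA.
  suff -> : \sum_(T : {set 'I_m} | (#|T| == k) && allcut r' T) N x y (u T)
    = c *: \sum_(T : {set 'I_m} | (#|T| == k) && allcut ((x, y) :: r') T) u T by [].
  rewrite scaler_sumr big_mkcondr [RHS]big_mkcondr /=.
  apply: eq_bigr => T /eqP Tk; rewrite (N_line x y T) ?uv //.
  by case: cuts; case: (allcut r' T); rewrite ?scale0r ?scaler0.
rewrite (big_pred1 S) => [Wd|T]; first by exists d.
apply/andP/eqP => [[/eqP Tk /allP Tr]|->].
  by apply: eq_of_cuts => // x y xS yS; apply: (Tr (x, y)); rewrite rP xS.
split; first exact/eqP.
by apply/allP => -[x y]; rewrite rP /cuts => /andP[-> /negPf->].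
Qed.

(** Exchanging an element of [S] outside [T] for one of [T] outside [S] shrinks [T :\: S]. *)
Lemma mem_family_exchange W S T : stable W -> #|S| = k -> #|T| = k ->
  v S \in W -> v T \in W.
Proof.
move=> W_stable; elim: {S}_.+1 {-2}S (ltnSn #|T :\: S|) => // d IHd S le_d Sk Tk vS.
have [TS|/subsetPn[y yT yS]] := boolP (T \subset S).
  by have /eqP -> : T == S by rewrite eqEcard TS Sk Tk leqnn.
have [x xS xT] : exists2 x, x \in S & x \notin T.
  apply/subsetPn; apply: contra yS => ST.
  by have /eqP -> : S == T by rewrite eqEcard ST Sk Tk leqnn.
have [e e_neq0 KS] := K_exchange Sk xS yS.
have xy : x != y by apply: contraNneq xT => ->.
apply: IHd (_ : v (y |: S :\ x) \in W) => //.
- rewrite -ltnS (leq_trans _ le_d) // ltnS proper_card //.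
  apply/properP; split.
    apply/subsetP => z; rewrite !inE !negb_or !negb_and negbK => /andP[/andP[_]].
    by case/orP => [/eqP-> xT'|-> -> //]; rewrite xT' in xT.
  by exists y; rewrite !inE ?yT ?yS // eqxx.
- by rewrite cardsU1 !inE (negPf yS) andbF /= -Sk (cardsD1 x S) xS.
- rewrite -[v _](scalerK e_neq0) memvZ // -KS.
  by have [] := W_stable x y xy _ vS.
Qed.

Hypothesis v_neq0 : forall T, #|T| = k -> v T != 0.

(** Isolation inside the zero subspace amounts to linear independence of the family. *)
Lemma dim_family_span : \dim family_span = 'C(m, k).
Proof.
have /directvP/= -> : directv family_span.
  apply/directv_sum_independent => u uv u0 T /eqP Tk.
  apply/eqP; rewrite -memv0; apply: mem_family_isolate Tk _ _ => //.
  - by move=> x y _ w; rewrite memv0 => /eqP ->; rewrite !linear0 mem0v.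
  - by move=> S Sk; apply: uv; apply/eqP.
  - by rewrite u0 mem0v.
under eq_bigr => T /eqP Tk do rewrite dim_vline v_neq0 //.
by rewrite sum1dep_card card_draws card_ord.
Qed.

Lemma family_span_sub W S : stable W -> #|S| = k -> v S \in W ->
  (family_span <= W)%VS.
Proof.
move=> W_stable Sk vS; apply/subv_sumP => T /eqP Tk; rewrite -memvE.
exact: mem_family_exchange vS.
Qed.

(** A nonzero vector of [W] has a nonzero component; isolation puts it into [W], and exchanges
    produce the rest of the family. *)
Lemma family_span_minimal W : stable W -> (W <= family_span)%VS -> W != 0%VS ->
  W = family_span.
Proof.
move=> W_stable WU W_neq0; apply/eqP; rewrite eqEsubv WU /=.
have : vpick W \in family_span by apply: (subvP WU); apply: memv_pick.
case/memv_sumP=> u uv def_w.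
have [S /= /andP[/eqP Sk uS_neq0]|u0] :=
    pickP [pred S : {set 'I_m} | (#|S| == k) && (u S != 0)]; last first.
  move: W_neq0; rewrite -vpick0 def_w big1 ?eqxx // => S Sk.
  by have /= := u0 S; rewrite Sk /= => /negbFE/eqP.
apply: (family_span_sub W_stable Sk).
have uS_W : u S \in W.
  apply: mem_family_isolate Sk _ _ => // [T Tk|]; first by apply: uv; apply/eqP.
  by rewrite -def_w memv_pick.
have /vlineP[d def_u] := uv S (introT eqP Sk).
move: uS_neq0 uS_W; rewrite def_u scaler_eq0 negb_or => /andP[d_neq0 _] uS_W.
by rewrite -[v S](scalerK d_neq0) memvZ.
Qed.

End ExchangeFamily.

(** * Clifford products acting on an invariant form *)

Section FormAct.
Variables (R : fieldType) (n k : nat).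
Implicit Types (A B : 'M[R]_n) (F : Lambda R n k).

Lemma form_actZl a A F : form_act k (a *: A) F = a *: form_act k A F.
Proof. by apply: subvs_inj; rewrite form_actE linearZ /= !form_actE tensor_actZl. Qed.

Lemma form_act_comm A B F :
  form_act k A (form_act k B F) - form_act k B (form_act k A F)
  = form_act k (A *m B - B *m A) F.
Proof. by apply: subvs_inj; rewrite linearB /= !form_actE tensor_act_comm. Qed.

End FormAct.

Lemma duality_tensor0 (R : fieldType) n (F : tensor R n 4) : duality_tensor 0 F = 0.
Proof.
apply/ffunP=> i; rewrite !ffunE big1 ?mulr0 // => s _; rewrite ffunE.
by rewrite !big1 ?mulr0 // => p _; rewrite big1 // => q _; rewrite ffunE mul0r.
Qed.

Lemma duality_op_equiv (R : fieldType) n (Theta : tensor R n 4) A :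
  A \in stabilizer Theta -> forall F,
  duality_op Theta (form_act 4 A F) = form_act 4 A (duality_op Theta F).
Proof.
move=> /andP[A_so /eqP A_Theta] F; apply: subvs_inj.
rewrite form_actE !duality_opE tensor_act_duality // A_Theta form_actE.
by rewrite duality_tensor0 add0r.
Qed.

Section CliffordProducts.
Variables (R : numFieldType) (n m : nat) (gamma : 'I_m -> 'M[R]_n.+1).
Hypothesis gamma_sq : forall a, gamma a * gamma a = -1.
Hypothesis gamma_anti : forall a b, a != b -> gamma a * gamma b = - (gamma b * gamma a).
Implicit Types (a b x y : 'I_m) (T : {set 'I_m}) (r : seq 'I_m).

Definition gamma_prod T := \prod_(a in T) gamma a.

(** The symmetric difference of [T] and {x}: the effect on [T] of multiplying by [gamma x]. *)
Definition toggle x T : {set 'I_m} := [set a | (a \in T) (+) (a == x)].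

Lemma in_toggle a x T : (a \in toggle x T) = (a \in T) (+) (a == x).
Proof. by rewrite inE. Qed.

(** [gamma x] moves to its own place, changing sign at each factor passed; there it is inserted, or
    squares to -1 with the factor already present. *)
Lemma mul_gamma_prod_seq x T r : uniq r -> x \in r ->
  exists2 d, d != 0 & gamma x * \prod_(a <- r | a \in T) gamma a
                      = d *: \prod_(a <- r | a \in toggle x T) gamma a.
Proof.
elim: r => // c r IHr /= /andP[c_r r_uniq]; rewrite !big_cons inE in_toggle.
have [-> _|xc /= x_r] := eqVneq x c; last first.
  rewrite addbF; have [d d_neq0 IH] := IHr r_uniq x_r.
  case: ifP => _; last by exists d.
  exists (- d); rewrite ?oppr_eq0 // mulrA gamma_anti // mulNr -mulrA IH.
  by rewrite -scalerAr scaleNr.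
have -> : \prod_(a <- r | a \in toggle c T) gamma a = \prod_(a <- r | a \in T) gamma a.
  rewrite !(big_seq_cond (fun a => a \in _)); apply: eq_bigl => a; rewrite in_toggle.
  by case: eqP => [->|_]; rewrite ?addbF // (negPf c_r).
rewrite addbT; case: ifP => cT /=.
  by exists (-1); rewrite ?oppr_eq0 ?oner_neq0 // mulrA gamma_sq scaleN1r mulN1r.
by exists 1; rewrite ?oner_neq0 // scale1r.
Qed.

Lemma mul_gamma_prod x T :
  exists2 d, d != 0 & gamma x * gamma_prod T = d *: gamma_prod (toggle x T).
Proof. by apply: mul_gamma_prod_seq; rewrite ?index_enum_uniq ?mem_index_enum. Qed.

(** [gamma x] anticommutes with every factor except itself. *)
Lemma gamma_prod_comm x T :
  gamma_prod T * gamma x = (-1) ^+ #|T :\ x| *: (gamma x * gamma_prod T).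
Proof.
have -> : (-1) ^+ #|T :\ x| = \prod_(a in T) (if a == x then 1 else -1) :> R.
  rewrite -prodr_const [LHS]big_mkcond [RHS]big_mkcond; apply: eq_bigr => a _.
  by rewrite !inE; case: eqP; case: (a \in T).
rewrite /gamma_prod; elim: (index_enum _) => [|c r IHr]; rewrite ?big_nil ?big_cons.
  by rewrite mulr1 mul1r scale1r.
case: ifP => // _; rewrite -mulrA IHr -scalerAr; case: eqP => [->|/eqP cx].
  by rewrite mul1r.
by rewrite mulN1r scaleNr !mulrA (gamma_anti cx) mulNr scalerN.
Qed.

Hypothesis gamma_skew : forall a, (gamma a)^T = - gamma a.

Lemma gamma_mul_sq x y : x != y -> (gamma x * gamma y) * (gamma x * gamma y) = -1.
Proof.
move=> xy; rewrite -mulrA [gamma y * _]mulrA [gamma y * gamma x]gamma_anti 1?eq_sym //.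
by rewrite mulNr -mulrA gamma_sq mulrN1 opprK gamma_sq.
Qed.

Lemma gamma_mul_skew x y : x != y -> (gamma x * gamma y)^T = - (gamma x * gamma y).
Proof. by move=> xy; rewrite trmx_mul !gamma_skew mulmxN mulNmx opprK gamma_anti // opprK. Qed.

(** The exponents #|T :\ x| and #|T :\ y| differ in parity exactly when one of [x], [y] lies in
    [T]. *)
Lemma gamma_mul_comm x y T : x != y ->
  gamma_prod T * (gamma x * gamma y)
  = (if cuts T x y then -1 else 1) *: (gamma x * gamma y * gamma_prod T).
Proof.
move=> xy; rewrite mulrA gamma_prod_comm -scalerAl -[_ * gamma_prod T * _]mulrA gamma_prod_comm.
rewrite -scalerAr scalerA mulrA; congr (_ *: _).
rewrite -exprD -signr_odd oddD.
have odd_card z : odd #|T :\ z| = odd #|T| (+) (z \in T).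
  by rewrite (cardsD1 z T) oddD addbAC oddb addbb.
by rewrite !odd_card addbACA addbb /cuts; case: (x \in T); case: (y \in T).
Qed.

(** The vector representation of so(m) on the span of the [gamma a], scaled by 2. *)
Lemma gamma_vec_comm x y a : x != y ->
  gamma x * gamma y * gamma a - gamma a * (gamma x * gamma y)
  = 2 *: ((a == x)%:R *: gamma y - (a == y)%:R *: gamma x).
Proof.
move=> xy; have yx : y != x by rewrite eq_sym.
have [->|ax] := eqVneq a x.
  rewrite (negPf xy) scale1r scale0r subr0 -mulrA (gamma_anti yx) mulrN.
  by rewrite !mulrA gamma_sq mulN1r opprK scaler_nat mulr2n.
have [->|ay] := eqVneq a y.
  rewrite scale1r scale0r add0r mulrA (gamma_anti yx) mulNr opprK.
  by rewrite -mulrA gamma_sq mulrN1 scalerN scaler_nat mulr2n opprD.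
rewrite !scale0r subrr scaler0 -mulrA (gamma_anti (b := a)) 1?eq_sym //.
by rewrite mulrN !mulrA (gamma_anti (b := a)) 1?eq_sym // mulNr opprK subrr.
Qed.

Variables (k : nat) (Theta : Lambda R n.+1 k).
Hypothesis Theta_inv : forall x y, x != y ->
  form_act k (gamma x * gamma y) Theta = 0.

Definition rotation x y : 'End(Lambda R n.+1 k) := form_act k (gamma x * gamma y).

(** With K the rotation, this is K^2 (K^2 + 16). K^2 has the values 0 and -4 on Clifford forms, and
    also -16 on the symmetric square; the polynomial kills 0 and -16 and sends -4 to -48. *)
Definition cut_op x y : 'End(Lambda R n.+1 k) :=
  (rotation x y \o rotation x y \o (rotation x y \o rotation x y + 16 *: \1))%VF.

Definition clifford_form T : Lambda R n.+1 k := form_act k (gamma_prod T) Theta.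

Lemma cut_opE x y u : cut_op x y u
  = rotation x y (rotation x y (rotation x y (rotation x y u)))
    + 16 *: rotation x y (rotation x y u).
Proof.
by rewrite !comp_lfunE add_lfunE scale_lfunE id_lfunE comp_lfunE !linearD !linearZ.
Qed.

(** The rotation annihilates [Theta], so only its commutator with [A] remains. *)
Lemma rotation_form x y A : x != y -> rotation x y (form_act k A Theta)
  = form_act k (gamma x * gamma y * A - A * (gamma x * gamma y)) Theta.
Proof.
by move=> xy; rewrite -form_act_comm Theta_inv // linear0 subr0.
Qed.

Lemma rotation_clifford x y T : x != y -> rotation x y (clifford_form T)
  = if cuts T x y then 2 *: form_act k (gamma x * gamma y * gamma_prod T) Theta else 0.
Proof.
move=> xy; rewrite rotation_form // gamma_mul_comm //; case: cuts.
  by rewrite scaleN1r opprK -mulr2n -scaler_nat form_actZl.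
(* Writing the zero matrix as a multiple by 0 makes homogeneity in the matrix applicable. *)
by rewrite scale1r subrr -[0](scale0r (0 : 'M[R]_n.+1)) form_actZl scale0r.
Qed.

(** In the cut case [gamma_prod T] anticommutes with K = [gamma x * gamma y], so each commutator
    doubles, and K^2 = -1 gives -4. *)
Lemma rotation2_clifford x y T : x != y -> rotation x y (rotation x y (clifford_form T))
  = (if cuts T x y then - 4 else 0) *: clifford_form T.
Proof.
move=> xy; rewrite rotation_clifford //; have := gamma_mul_comm T xy.
case: cuts => [anti|_]; last by rewrite linear0 scale0r.
rewrite linearZ /= rotation_form // -[_ * gamma_prod T * _]mulrA anti.
rewrite scaleN1r mulrN opprK mulrA gamma_mul_sq // mulN1r -mulr2n -scaler_nat.
by rewrite -scaleN1r !form_actZl !scalerA; congr (_ *: _); ring.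
Qed.

Lemma cut_op_clifford x y T : x != y ->
  cut_op x y (clifford_form T) = (if cuts T x y then - 48 else 0) *: clifford_form T.
Proof.
move=> xy; rewrite cut_opE !rotation2_clifford // !linearZ /= rotation2_clifford //.
by rewrite !scalerA -scalerDl; congr (_ *: _); case: cuts; ring.
Qed.

(** Multiplying by [gamma x * gamma y] toggles both memberships, which here amounts to exchanging
    [x] for [y]. *)
Lemma rotation_exchange x y T : x \in T -> y \notin T ->
  exists2 d, d != 0 & rotation x y (clifford_form T) = d *: clifford_form (y |: T :\ x).
Proof.
move=> xT yT; have xy : x != y by apply: contraNneq yT => <-.
rewrite rotation_clifford // /cuts xT (negPf yT) /=.
have [d d_neq0 yE] := mul_gamma_prod y T.
have [e e_neq0 xE] := mul_gamma_prod x (toggle y T).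
exists (2 * (d * e)); first by rewrite !mulf_neq0 ?pnatr_eq0.
rewrite -mulrA yE -scalerAr xE !form_actZl !scalerA; congr (_ *: form_act _ (gamma_prod _) _).
apply/setP=> z; rewrite !in_toggle !inE.
have [->|zx] := eqVneq z x; first by rewrite xT (negPf xy).
by have [->|_] := eqVneq z y; rewrite ?(negPf yT) ?addbF ?andbT.
Qed.

End CliffordProducts.

(** * The symmetric square of the vector representation *)

Section SymmetricSquare.
Variables (R : numFieldType) (n m : nat) (gamma : 'I_m -> 'M[R]_n.+1).
Hypothesis gamma_sq : forall a, gamma a * gamma a = -1.
Hypothesis gamma_anti : forall a b, a != b -> gamma a * gamma b = - (gamma b * gamma a).
Hypothesis gamma_skew : forall a, (gamma a)^T = - gamma a.
Implicit Types (a b x y : 'I_m) (S : 'M[R]_m) (T : {set 'I_m}).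

Local Notation rotation := (rotation gamma 4).
Local Notation cut_op := (cut_op gamma 4).

Definition gamma_wedge a b : Lambda R n.+1 4 :=
  vsproj (alt_space R n.+1 4) (wedge2 (gamma a) (gamma b)).

Definition square_form S : Lambda R n.+1 4 := \sum_a \sum_b S a b *: gamma_wedge a b.

Lemma square_form_is_linear : linear square_form.
Proof.
move=> d S S'; rewrite scaler_sumr -big_split; apply: eq_bigr => a _.
rewrite scaler_sumr -big_split; apply: eq_bigr => b _.
by rewrite !mxE scalerDl scalerA.
Qed.

HB.instance Definition _ := GRing.isSemilinear.Build R _ _ _ square_form
  (GRing.semilinear_linear square_form_is_linear).

(* The action of 2 (e_yx - e_xy) in so(m) on the symmetric square of R^m *)
Definition rotation_mx x y S : 'M[R]_m := \matrix_(i, j) (2 *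
  ((i == y)%:R * S x j - (i == x)%:R * S y j
   + (j == y)%:R * S i x - (j == x)%:R * S i y)).

(** Since the rotation matrix is skew, its derivation on each factor is the commutator computed in
    [gamma_vec_comm]. *)
Lemma rotation_wedge x y a b : x != y -> rotation x y (gamma_wedge a b)
  = 2 *: ((a == x)%:R *: gamma_wedge y b - (a == y)%:R *: gamma_wedge x b
          + (b == x)%:R *: gamma_wedge a y - (b == y)%:R *: gamma_wedge a x).
Proof.
move=> xy; apply: subvs_inj; rewrite form_actE !(linearB, linearD, linearZ) /=.
rewrite !vsprojK ?antisym_alt // tensor_act_wedge2.
rewrite gamma_mul_skew // !mulmxN !mulmxE !gamma_vec_comm //.
rewrite wedge2Zl wedge2Zr -scalerDr; congr (_ *: _).
rewrite -![- (_ *: gamma _)]scaleNr !wedge2Dl !wedge2Dr !wedge2Zl !wedge2Zr.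
by rewrite !scaleNr !scalerN addrA.
Qed.

Lemma sum_delta (V : lmodType R) (f : 'I_m -> V) x : \sum_a (a == x)%:R *: f a = f x.
Proof.
rewrite (bigD1 x) //= eqxx scale1r big1 ?addr0 // => a /negPf->.
by rewrite scale0r.
Qed.

(** Equivariance of [square_form]: rotations can now be computed on m by m matrices. *)
Lemma rotation_square x y S : x != y ->
  rotation x y (square_form S) = square_form (rotation_mx x y S).
Proof.
move=> xy; transitivity (2 *:
   (\sum_b S x b *: gamma_wedge y b - \sum_b S y b *: gamma_wedge x b
  + \sum_a S a x *: gamma_wedge a y - \sum_a S a y *: gamma_wedge a x)).
  rewrite -(sum_delta (fun a => \sum_b S a b *: gamma_wedge y b)).
  rewrite -(sum_delta (fun a => \sum_b S a b *: gamma_wedge x b)).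
  under [X in _ + X - _]eq_bigr => a _ do
    rewrite -(sum_delta (fun b => S a b *: gamma_wedge a y)).
  under [X in _ - X]eq_bigr => a _ do
    rewrite -(sum_delta (fun b => S a b *: gamma_wedge a x)).
  rewrite -sumrB -big_split -sumrB scaler_sumr linear_sum; apply: eq_bigr => a _ /=.
  rewrite !scaler_sumr -sumrB -big_split -sumrB scaler_sumr linear_sum.
  apply: eq_bigr => b _ /=; rewrite linearZ /= rotation_wedge //.
  have scaleC d e (u : Lambda R n.+1 4) : d *: (e *: u) = e *: (d *: u).
    by rewrite !scalerA mulrC.
  rewrite [LHS]scaleC; congr (_ *: _); rewrite !(scalerBr, scalerDr).
  by rewrite ![S a b *: (_ *: _)]scaleC.
rewrite -(sum_delta (fun a => \sum_b S x b *: gamma_wedge a b)).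
rewrite -(sum_delta (fun a => \sum_b S y b *: gamma_wedge a b)).
under [X in _ + X - _]eq_bigr => a _ do
  rewrite -(sum_delta (fun b => S a x *: gamma_wedge a b)).
under [X in _ - X]eq_bigr => a _ do
  rewrite -(sum_delta (fun b => S a y *: gamma_wedge a b)).
rewrite -sumrB -big_split -sumrB scaler_sumr; apply: eq_bigr => a _ /=.
rewrite !scaler_sumr -sumrB -big_split -sumrB scaler_sumr.
apply: eq_bigr => b _ /=; rewrite mxE -scalerA; congr (_ *: _).
by rewrite !scalerBl scalerDl scalerBl !scalerA.
Qed.

Lemma rotation_mx_sym x y S : S^T = S -> (rotation_mx x y S)^T = rotation_mx x y S.
Proof.
move=> S_sym; have symE i j : S i j = S j i by rewrite -{1}S_sym mxE.
by apply/matrixP=> i j; rewrite !mxE (symE i x) (symE i y) (symE j x) (symE j y); ring.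
Qed.

(** The projection to the eigenvalue -4 of the squared rotation: it keeps the entries with exactly
    one index in {x, y}. *)
Definition cut_mx x y S : 'M[R]_m :=
  \matrix_(i, j)
    ((((i == x) || (i == y)) != ((j == x) || (j == y)))%:R * S i j).

Lemma cut_op_square x y S : x != y -> S^T = S ->
  cut_op x y (square_form S) = - 48 *: square_form (cut_mx x y S).
Proof.
move=> xy S_sym; have symE i j : S i j = S j i by rewrite -{1}S_sym mxE.
rewrite cut_opE !rotation_square // -!linearZ -linearD /=; congr square_form.
have yx : (y == x) = false by rewrite eq_sym (negPf xy).
apply/matrixP=> i j; rewrite !mxE.
have [->|ix] := eqVneq i x; have [->|jx] := eqVneq j x;
  rewrite ?eqxx ?yx ?(negPf xy);
  try (have [->|jy] := eqVneq j y); try (have [->|iy] := eqVneq i y);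
  rewrite ?eqxx ?yx ?(negPf xy) ?(symE y x) /=; ring.
Qed.

(** For T = {a, b} this is e_ab + e_ba; indexing by sets matches the exchange family. *)
Definition pair_mx T : 'M[R]_m := \matrix_(i, j) [&& i != j, i \in T & j \in T]%:R.

Definition pair_form T := square_form (pair_mx T).

Lemma pair_mx_sym T : (pair_mx T)^T = pair_mx T.
Proof. by apply/matrixP=> i j; rewrite !mxE eq_sym [(i \in T) && _]andbC. Qed.

Lemma pair_mx2 a b : a != b -> pair_mx [set a; b] = delta_mx a b + delta_mx b a.
Proof.
move=> ab; have ba : b != a by rewrite eq_sym.
apply/matrixP=> i j; rewrite !mxE !inE.
have [ia|_] := eqVneq i a; [|have [ib|_] := eqVneq i b];
  (have [ja|_] := eqVneq j a; [|have [jb|_] := eqVneq j b]); subst;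
  by rewrite ?eqxx ?(negPf ab) ?(negPf ba) /= ?andbF ?addr0 ?add0r.
Qed.

Lemma cut_op_pair x y T : x != y -> #|T| = 2%N ->
  cut_op x y (pair_form T) = (if cuts T x y then - 48 else 0) *: pair_form T.
Proof.
move=> xy /eqP/cards2P[a [b [ab ->]]]; rewrite cut_op_square ?pair_mx_sym //.
suff -> : cut_mx x y (pair_mx [set a; b])
    = (cuts [set a; b] x y)%:R *: pair_mx [set a; b].
  by rewrite linearZ scalerA /=; case: cuts; rewrite ?mulr1 ?mulr0.
have cutE : cuts [set a; b] x y
    = (((a == x) || (a == y)) != ((b == x) || (b == y))).
  rewrite /cuts !inE ![x == _]eq_sym ![y == _]eq_sym.
  have [ax|_] := eqVneq a x; have [bx|_] := eqVneq b x;
  have [ay|_] := eqVneq a y; have [by_|_] := eqVneq b y => //=;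
  by subst; move: xy ab; rewrite eqxx.
apply/matrixP=> i j; rewrite pair_mx2 // !mxE cutE.
have [/andP[/eqP -> /eqP ->] //|_] := boolP ((i == a) && (j == b)).
have [/andP[/eqP -> /eqP ->]|_] := boolP ((i == b) && (j == a)).
  by rewrite eq_sym.
by rewrite addr0 !mulr0.
Qed.

Lemma rotation_mx_is_linear x y : linear (rotation_mx x y).
Proof. by move=> d S S'; apply/matrixP=> i j; rewrite !mxE; ring. Qed.

HB.instance Definition _ x y := GRing.isSemilinear.Build R _ _ _ (rotation_mx x y)
  (GRing.semilinear_linear (rotation_mx_is_linear x y)).

Lemma rotation_mx_delta x y a b : rotation_mx x y (delta_mx a b) = 2 *:
  ((a == x)%:R *: delta_mx y b - (a == y)%:R *: delta_mx x b
   + (b == x)%:R *: delta_mx a y - (b == y)%:R *: delta_mx a x) :> 'M[R]_m.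
Proof.
apply/matrixP=> i j; rewrite !mxE -!mulnb !natrM.
by rewrite ![x == _]eq_sym ![y == _]eq_sym; ring.
Qed.

(** The metric is invariant; this is what makes the four-form invariant once it is written as a
    multiple of [square_form] at the identity. *)
Lemma rotation_mx1 x y : rotation_mx x y 1%:M = 0 :> 'M[R]_m.
Proof.
apply/matrixP=> i j; rewrite !mxE ![x == _]eq_sym ![y == _]eq_sym; ring.
Qed.

Lemma rotation_pair x y T : #|T| = 2%N -> x \in T -> y \notin T ->
  rotation x y (pair_form T) = 2 *: pair_form (y |: T :\ x).
Proof.
move=> T2 xT yT; have xy : x != y by apply: contraNneq yT => <-.
have /cards1P[b Tx] : #|T :\ x| == 1%N.
  by rewrite -eqSS -[X in _ == X]T2 (cardsD1 x T) xT.
have xb : x != b by have := setD11 x T; rewrite Tx inE => /negbT.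
have yb : y != b.
  by apply: contraNneq yT => ->; have := set11 b; rewrite -Tx inE => /andP[].
rewrite rotation_square // -linearZ /=; congr square_form.
have -> : T = [set x; b] by rewrite -Tx setD1K.
have -> : y |: [set x; b] :\ x = [set y; b].
  by rewrite setU1K // inE.
rewrite !pair_mx2 // linearD /= !rotation_mx_delta !eqxx.
rewrite [b == x]eq_sym [b == y]eq_sym (negPf xb) ?[b == y]eq_sym (negPf yb) (negPf xy).
by rewrite !scale0r !scale1r !subr0 !add0r !addr0 -scalerDr.
Qed.

Hypothesis m_gt2 : (2 < m)%N.
Hypothesis m_neq4 : m != 4%N.
Local Notation stable := (stable rotation cut_op).

Lemma pair_family_neq : (2 + 2 != m)%N.
Proof. by rewrite eq_sym. Qed.

Lemma natr_neg48_neq0 : - 48 != 0 :> R.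
Proof. by rewrite oppr_eq0 pnatr_eq0. Qed.

Lemma rotation_pair_exchange x y T : #|T| = 2%N -> x \in T -> y \notin T ->
  exists2 d, d != 0 & rotation x y (pair_form T) = d *: pair_form (y |: T :\ x).
Proof. by exists 2; rewrite ?pnatr_eq0 // rotation_pair. Qed.

(** Cutting with [a] and a third index [z] removes the diagonal and keeps the entry at (a, b). What
    is left is a combination of pair matrices, to which isolation applies. *)
Lemma pair_form_mem W S a b : stable W -> S^T = S -> a != b -> S a b != 0 ->
  square_form S \in W -> pair_form [set a; b] \in W.
Proof.
move=> W_stable S_sym ab Sab SW.
have symE i j : S i j = S j i by rewrite -{1}S_sym mxE.
have [z az bz] : exists2 z, a != z & b != z.
  have [z] : exists z, z \notin [set a; b].
    apply/existsP; apply: contraLR m_gt2; rewrite negb_exists -leqNgt => /forallP abT.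
    have : (#|'I_m| <= #|[set a; b]|)%N.
      by apply/subset_leq_card/subsetP=> z _; exact/negbNE/abT.
    by rewrite card_ord cards2 ab.
  by rewrite !inE negb_or ![z == _]eq_sym => /andP[]; exists z.
pose S' := cut_mx a z S.
have S'_W : square_form S' \in W.
  have [_] := W_stable a z az _ SW; rewrite cut_op_square //.
  by rewrite rpredZeq (negPf natr_neg48_neq0).
have S'_sym i j : S' i j = S' j i by rewrite !mxE symE eq_sym.
have S'_diag i : S' i i = 0 by rewrite mxE eqxx mul0r.
have S'_ab : S' a b != 0.
  rewrite mxE eqxx [b == a]eq_sym (negPf ab) (negPf bz) mul1r //.
(* [mask T] is the component of S' along the pair [T]. *)
clearbody S'; pose mask T : 'M[R]_m := \matrix_(i, j) (S' i j * pair_mx T i j).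
have mask2 c d : c != d -> mask [set c; d] = S' c d *: pair_mx [set c; d].
  move=> cd; apply/matrixP=> i j; rewrite /mask pair_mx2 // !mxE.
  have [/andP[/eqP -> /eqP ->] //|_] := boolP ((i == c) && (j == d)).
  have [/andP[/eqP -> /eqP ->]|_] := boolP ((i == d) && (j == c)).
    by rewrite S'_sym.
  by rewrite addr0 !mulr0.
have sum_mask : \sum_(T : {set 'I_m} | #|T| == 2%N) mask T = S'.
  apply/matrixP=> i j; rewrite summxE.
  have [->|ij] := eqVneq i j.
    by rewrite big1 => [|T _]; rewrite ?mxE S'_diag ?mul0r.
  rewrite (bigD1 [set i; j]) ?cards2 ?ij //= big1 => [|T /andP[/eqP T2 Tij]].
    by rewrite addr0 mask2 // pair_mx2 // !mxE !eqxx (negPf ij) addr0 mulr1.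
  rewrite !mxE ij /=; case: andP => [[iT jT]|]; last by rewrite mulr0.
  case/eqP: Tij; apply/esym/eqP; rewrite eqEcard cards2 ij T2 andbT.
  by apply/subsetP=> l; rewrite !inE => /orP[]/eqP->.
have : square_form (mask [set a; b]) \in W.
  apply: (mem_family_isolate (v := pair_form) natr_neg48_neq0 pair_family_neq _
    (u := fun T => square_form (mask T)) W_stable).
  - by move=> x y T xy T2; apply: cut_op_pair.
  - by rewrite cards2 ab.
  - move=> T /eqP/cards2P[c [d [cd ->]]]; rewrite mask2 // linearZ.
    by rewrite memvZ ?memv_line.
  - by rewrite -linear_sum sum_mask.
by rewrite mask2 // linearZ /= rpredZeq (negPf S'_ab).
Qed.

(** An off-diagonal entry is needed. If [S] is diagonal with two different entries, rotating their
    plane creates one; a constant diagonal of trace 0 vanishes. *)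
Lemma pair_form_mem_traceless W S : stable W -> S^T = S -> \tr S = 0 -> S != 0 ->
  square_form S \in W -> exists2 T : {set 'I_m}, #|T| = 2%N & pair_form T \in W.
Proof.
move=> W_stable S_sym trS S_neq0 SW.
suff [a [b [S' [ab [S'_sym S'_ab S'W]]]]] : exists a b S',
    a != b /\ [/\ S'^T = S', S' a b != 0 & square_form S' \in W].
  by exists [set a; b]; [rewrite cards2 ab | apply: pair_form_mem S'W].
have [[a b] /= /andP[ab Sab]|S_diag] :=
    pickP [pred p : 'I_m * 'I_m | (p.1 != p.2) && (S p.1 p.2 != 0)].
  by exists a, b, S.
have Sij i j : i != j -> S i j = 0.
  by move=> ij; have /= := S_diag (i, j); rewrite ij /= => /negbFE/eqP.
have [[a b] /= Sab|S_const] :=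
    pickP [pred p : 'I_m * 'I_m | S p.1 p.1 != S p.2 p.2].
  have ab : a != b by apply: contraNneq Sab => ->.
  exists a, b, (rotation_mx a b S); split=> //; split.
  - exact: rotation_mx_sym.
  - rewrite mxE !eqxx (negPf ab) [b == a]eq_sym (negPf ab).
    suff -> : 2 * (0 * S a b - 1 * S b b + 1 * S a a - 0 * S a b) = 2 * (S a a - S b b) :> R.
      by rewrite mulf_neq0 ?pnatr_eq0 // subr_eq0.
    by ring.
  - by rewrite -rotation_square //; have [] := W_stable a b ab _ SW.
have m_gt0 : (0 < m)%N by apply: leq_trans m_gt2.
pose i0 := Ordinal m_gt0; have Sii i : S i i = S i0 i0.
  by have /= := S_const (i, i0) => /negbFE/eqP.
case/eqP: S_neq0; apply/matrixP=> i j; rewrite mxE.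
have [<-|ij] := eqVneq i j; last exact: Sij.
move: trS; rewrite /mxtrace; under eq_bigr do rewrite Sii.
rewrite sumr_const card_ord -mulr_natl => /eqP.
by rewrite mulf_eq0 pnatr_eq0 -leqn0 leqNgt m_gt0 Sii => /eqP.
Qed.

(** The target has dimension C(m, 2) + 1, so rank-nullity bounds the dimension of the kernel, the
    traceless symmetric matrices, from below. *)
Definition traceless_obstruction S :
    ({ffun {t : 2.-tuple 'I_m | increasing t} -> R^o} * R^o)%type :=
  ([ffun t => S (tnth (val t) 0) (tnth (val t) 1) - S (tnth (val t) 1) (tnth (val t) 0)],
   \tr S).

Lemma traceless_obstruction_is_linear : linear traceless_obstruction.
Proof.
move=> d S S'; congr pair; last by rewrite linearP.
by apply/ffunP=> t; rewrite !ffunE !mxE /= scalerBr addrACA opprD.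
Qed.

HB.instance Definition _ := GRing.isSemilinear.Build R _ _ _ traceless_obstruction
  (GRing.semilinear_linear traceless_obstruction_is_linear).

Definition traceless_sym : {vspace 'M[R]_m} := lker (linfun traceless_obstruction).

Lemma traceless_symP S : reflect (S^T = S /\ \tr S = 0) (S \in traceless_sym).
Proof.
rewrite memv_ker lfunE; apply: (iffP eqP) => [[/ffunP S_sym trS]|[S_sym trS]].
  split=> //; apply/matrixP=> i j; rewrite mxE.
  wlog ij : i j / (i < j)%N.
    by move=> H; case: (ltngtP i j) => [||/val_inj->] // /H.
  have incr_ij : increasing [tuple i; j] by rewrite /increasing /= ij.
  have := S_sym (exist _ [tuple i; j] incr_ij); rewrite !ffunE => /eqP.
  by rewrite subr_eq0 => /eqP.
congr pair; last exact: trS.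
apply/ffunP=> t; rewrite !ffunE; apply/eqP; rewrite subr_eq0.
by rewrite -{1}S_sym mxE.
Qed.

Lemma dim_traceless_sym : (m * m <= \dim traceless_sym + 'C(m, 2).+1)%N.
Proof.
rewrite -[leqLHS](dim_matrix R) -dimvf -(limg_ker_dim (linfun traceless_obstruction)).
rewrite capfv leq_add2l (leq_trans (dimvS (subvf _))) // dimvf.
rewrite /dim /= /dim /= muln1 card_sig addn1 ltnS.
by rewrite -card_ltn_sorted_tuples cardsE.
Qed.

Definition square_span := (linfun square_form @: traceless_sym)%VS.

Hypothesis pair_form_neq0 : exists2 T : {set 'I_m}, #|T| = 2%N & pair_form T != 0.

(** The zero subspace is stable, so a nonzero [S] with zero image would force every pair form to
    vanish. *)
Lemma dim_square_span_traceless : \dim square_span = \dim traceless_sym.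
Proof.
apply: limg_dim_eq; apply/eqP; rewrite -subv0; apply/subvP => S.
rewrite memv_cap memv0 memv_ker lfunE /= => /andP[/traceless_symP[S_sym trS] S0].
have stable0 : stable 0%VS.
  by move=> x y _ u; rewrite memv0 => /eqP->; rewrite !linear0 mem0v.
apply: contraT => S_neq0.
have [|T T2 T0] := pair_form_mem_traceless stable0 S_sym trS S_neq0.
  by rewrite memv0.
have [T' T'2 /eqP[]] := pair_form_neq0; apply/eqP; rewrite -memv0.
by apply: (mem_family_exchange rotation_pair_exchange stable0 T2 T'2).
Qed.

(** Exchanges give all pair forms, and rotating the pair {a, b} in its own plane gives 4 (e_bb -
    e_aa). Together these span the traceless symmetric matrices. *)
Lemma square_span_sub W T : stable W -> #|T| = 2%N -> pair_form T \in W ->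
  (square_span <= W)%VS.
Proof.
move=> W_stable T2 TW.
have pairW T' : #|T'| = 2%N -> pair_form T' \in W.
  by move=> T'2; apply: (mem_family_exchange rotation_pair_exchange W_stable T2 T'2).
have diagW a b : square_form (delta_mx b b - delta_mx a a) \in W.
  have [->|ab] := eqVneq a b; first by rewrite subrr linear0 mem0v.
  have [|+ _] := W_stable a b ab (pair_form [set a; b]).
    by apply: pairW; rewrite cards2 ab.
  rewrite rotation_square // pair_mx2 // linearD /= !rotation_mx_delta.
  rewrite !eqxx [b == a]eq_sym (negPf ab) !scale0r !scale1r !subr0 addr0 sub0r.
  by rewrite [- _ + _]addrC -scalerDl linearZ rpredZeq -natrD pnatr_eq0.
apply/subvP=> _ /memv_imgP[S /traceless_symP[S_sym trS] ->]; rewrite lfunE /=.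
have m_gt0 : (0 < m)%N by apply: leq_trans m_gt2.
pose i0 := Ordinal m_gt0.
(* The subtracted terms add up to 2 tr(S) e_i0i0 = 0, and make every summand traceless. *)
have : 2 *: S = \sum_i \sum_j S i j *:
    (delta_mx i j + delta_mx j i - (i == j)%:R *: (2 *: delta_mx i0 i0)).
  transitivity (S + S - (2 * \tr S) *: delta_mx i0 i0).
    by rewrite trS mulr0 scale0r subr0 scaler_nat mulr2n.
  rewrite {1}[S]matrix_sum_delta -{2}S_sym [S^T]matrix_sum_delta.
  rewrite [X in _ + X - _]exchange_big /mxtrace mulr_sumr scaler_suml.
  rewrite -big_split -sumrB; apply: eq_bigr => i _ /=.
  under [RHS]eq_bigr => j _ do rewrite scalerBr scalerDr.
  rewrite sumrB big_split /=; congr (_ + _ - _).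
    by apply: eq_bigr => j _; rewrite mxE.
  rewrite (bigD1 i) //= eqxx scale1r big1 ?addr0 => [|j ji].
    by rewrite scalerA mulrC.
  by rewrite eq_sym (negPf ji) scale0r scaler0.
move/(congr1 square_form); rewrite linearZ linear_sum /= => SE.
suff : 2 *: square_form S \in W by rewrite rpredZeq pnatr_eq0.
rewrite SE; apply: memv_suml => i _; rewrite linear_sum /=; apply: memv_suml => j _.
rewrite linearZ memvZ //=; have [->|ij] := eqVneq i j.
  by rewrite scale1r -mulr2n -scaler_nat -scalerBr linearZ memvZ ?diagW.
by rewrite scale0r subr0 -pair_mx2 //; apply: pairW; rewrite cards2 ij.
Qed.

End SymmetricSquare.

(** * Evaluation of integer tensors *)

Definition forall4 (P : seq nat -> bool) :=
  all (fun a => all (fun b => all (fun c => all (fun d => P [:: a; b; c; d])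
    (iota 0 8)) (iota 0 8)) (iota 0 8)) (iota 0 8).

Section IntegerTensors.
Variables (R : numFieldType).

(* Closed terms over int reduce by vm_compute, unlike big operators and finfuns. *)
Definition zsum (n : nat) (f : nat -> int) : int :=
  foldr (fun m acc => f m + acc) 0 (iota 0 n).

(** The signed sum over all rearrangements of [l], expanded by the choice of the first entry and not
    divided by k!. *)
Fixpoint zalt (k : nat) (f : seq nat -> int) (l : seq nat) : int :=
  if k is k'.+1 then
    zsum k (fun p => (if odd p then -1 else 1) *
      zalt k' (fun r => f (nth 0%N l p :: r)) (take p l ++ drop p.+1 l))
  else f [::].

Definition int_tensor n k (f : seq nat -> int) : tensor R n k :=
  [ffun i : k.-tuple 'I_n => (f (map val i))%:~R].

Definition int_mx n (g : nat -> nat -> int) : 'M[R]_n := \matrix_(i, j) (g i j)%:~R.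

Lemma zsumE n (f : nat -> int) : (zsum n f)%:~R = \sum_(m < n) (f m)%:~R :> R.
Proof.
rewrite -(big_mkord xpredT (fun m => (f m)%:~R)) /zsum /index_iota subn0.
by elim: (iota 0 n) => [|m r IHr] /=; rewrite ?big_nil // big_cons rmorphD /= IHr.
Qed.

(** A permutation amounts to the image of 0 and a permutation of the rest; bijectivity follows from
    injectivity by counting. *)
Lemma sum_perm_lift (V : nmodType) n (F : 'S_n.+1 -> V) :
  \sum_s F s = \sum_p \sum_(s : 'S_n) F (lift_perm ord0 p s).
Proof.
pose lift_pair (u : 'I_n.+1 * 'S_n) := lift_perm ord0 u.1 u.2.
rewrite pair_big (reindex lift_pair) //; apply: onW_bij; apply: inj_card_bij.
  move=> [p s] [q t]; rewrite /lift_pair /= => /permP eq_st.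
  have := eq_st ord0; rewrite !lift_perm_id => pq; congr pair => //.
  apply/permP=> j; have := eq_st (lift ord0 j); rewrite !lift_perm_lift pq.
  exact: lift_inj.
by rewrite card_prod card_Sn card_ord card_Sn factS.
Qed.

Lemma nth_map_val n k (i : k.-tuple 'I_n) (j : 'I_k) :
  nth 0%N (map val i) j = tnth i j.
Proof. by rewrite (nth_map (tnth i j)) ?size_tuple // -tnth_nth. Qed.

Lemma zaltE k (f : seq nat -> int) n (i : k.-tuple 'I_n) :
  (zalt k f (map val i))%:~R
  = \sum_(s : 'S_k) (-1) ^+ s * (f (map val (perm_idx s i)))%:~R :> R.
Proof.
elim: k f i => [|k IHk] f i.
  rewrite (big_pred1 1%g) => [|s]; last by apply/esym/eqP/permP => -[].
  rewrite odd_perm1 mul1r [zalt _ _ _]/=; congr ((f _)%:~R).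
  by apply/esym/size0nil; rewrite size_map size_tuple.
rewrite sum_perm_lift [zalt _ _ _]/= zsumE; apply: eq_bigr => p _.
pose i' := [tuple tnth i (lift p j) | j < k].
have -> : take p (map val i) ++ drop p.+1 (map val i) = map val i'.
  have sz : size (map val i) = k.+1 by rewrite size_map size_tuple.
  have pk : (p <= k)%N by rewrite -ltnS.
  have sz_take : size (take p (map val i)) = p by rewrite size_takel // sz ltnW.
  have sz_drop : size (drop p.+1 (map val i)) = (k - p)%N by rewrite size_drop sz subSS.
  apply: (@eq_from_nth _ 0%N) => [|j].
    by rewrite size_cat sz_take sz_drop subnKC // size_map size_tuple.
  rewrite size_cat sz_take sz_drop subnKC // => jk.
  rewrite (nth_map (tnth i p)) ?size_tuple // -(tnth_nth _ i' (Ordinal jk)) tnth_mktuple.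
  rewrite -[val _]/(nat_of_ord _) -nth_map_val /= /bump nth_cat sz_take; case: ltnP => [jp|pj].
    by rewrite nth_take.
  by rewrite nth_drop addSn subnKC.
rewrite intrM IHk mulr_sumr; apply: eq_bigr => s _.
(* The lift sending 0 to [p] has the sign of [s] times (-1)^p. *)
rewrite odd_lift_perm /= signr_addb mulrA; congr (_ * (f _)%:~R).
  by case: odd; rewrite ?expr1 ?expr0 ?rmorphN1 ?rmorph1.
rewrite nth_map_val /= enum_ordSl /= lift_perm_id -!map_comp; congr (_ :: _).
by apply: eq_map => j /=; rewrite tnth_mktuple lift_perm_lift.
Qed.

Lemma map_val_tuple4 n (i : 4.-tuple 'I_n) : map val i =
  [:: val (tnth i 0); val (tnth i 1); val (tnth i 2); val (tnth i 3)].
Proof. by rewrite {1}[i]tuple4_eta. Qed.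

Lemma forall4P (P : seq nat -> bool) (i : 4.-tuple 'I_8) :
  forall4 P -> P (map val i).
Proof.
have in_iota j : val (tnth i j) \in iota 0 8 by rewrite mem_iota ltn_ord.
move=> /allP/(_ _ (in_iota 0))/allP/(_ _ (in_iota 1)).
move=> /allP/(_ _ (in_iota 2))/allP/(_ _ (in_iota 3)).
by rewrite map_val_tuple4.
Qed.

(** The zero test skips the evaluation of [f] wherever the entry of [g] vanishes. *)
Definition zact (g : nat -> nat -> int) (f : seq nat -> int) (l : seq nat) : int :=
  zsum 4 (fun p => zsum 8 (fun m =>
    if g (nth 0%N l p) m == 0 then 0 else g (nth 0%N l p) m * f (set_nth 0%N l p m))).

Lemma tensor_act_int g f :
  tensor_act (int_mx 8 g) (int_tensor 8 4 f) = int_tensor 8 4 (zact g f).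
Proof.
apply/ffunP=> i; rewrite !ffunE zsumE; apply: eq_bigr => p _; rewrite zsumE.
apply: eq_bigr => m _; rewrite mxE ffunE nth_map_val.
have -> : map val (subst_idx p m i) = set_nth 0%N (map val i) p m.
  apply: (@eq_from_nth _ 0%N) => [|j].
    by rewrite size_set_nth !(size_map, size_tuple) (maxn_idPr (ltn_ord p)).
  rewrite size_map size_tuple => j4; rewrite -[j]/(nat_of_ord (Ordinal j4)).
  rewrite nth_map_val tnth_subst_idx nth_set_nth [RHS]/= -val_eqE [j == p]/=.
  by case: eqP => // _; apply/esym/(nth_map_val i (Ordinal j4)).
by case: eqP => [->|_]; rewrite ?mul0r ?intrM.
Qed.

Definition zwedge (g h : nat -> nat -> int) : seq nat -> int :=
  zalt 4 (fun l => g (nth 0 l 0) (nth 0 l 1) * h (nth 0 l 2) (nth 0 l 3)).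

Lemma wedge2_int g h : wedge2 (int_mx 8 g) (int_mx 8 h)
  = 24^-1 *: int_tensor 8 4 (zwedge g h).
Proof.
apply/ffunP=> i; rewrite !ffunE zaltE; congr (_ * _); apply: eq_bigr => s _.
by rewrite map_val_tuple4 ffunE !mxE intrM.
Qed.

Definition zdual (t f : seq nat -> int) : seq nat -> int :=
  zalt 4 (fun l => zsum 8 (fun m => zsum 8 (fun r =>
    if t [:: m; r; nth 0 l 0; nth 0 l 1] == 0 then 0 else
    t [:: m; r; nth 0 l 0; nth 0 l 1] * f [:: nth 0 l 2; nth 0 l 3; m; r]))).

Lemma duality_tensor_int t f :
  duality_tensor (int_tensor 8 4 t) (int_tensor 8 4 f) = 24^-1 *: int_tensor 8 4 (zdual t f).
Proof.
apply/ffunP=> i; rewrite /duality_tensor !ffunE zaltE; congr (_ * _).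
apply: eq_bigr => s _; congr (_ * _).
rewrite map_val_tuple4 ffunE zsumE; apply: eq_bigr => m _.
rewrite zsumE; apply: eq_bigr => r _; rewrite !ffunE /=.
by case: eqP => [->|_]; rewrite ?mul0r ?intrM.
Qed.

(** Both sides alternate, so the increasing indices suffice; 24 = 4! is the weight that [zdual]
    omits. *)
Lemma duality_tensor_check t f (c : int) :
  int_tensor 8 4 f \in alt_space R 8 4 ->
  forall4 (fun l => if sorted ltn l then zdual t f l == c * f l else true) ->
  duality_tensor (int_tensor 8 4 t) (int_tensor 8 4 f) = (c%:~R / 24) *: int_tensor 8 4 f.
Proof.
move=> fA check; apply: alt_ext; rewrite ?pnatr_eq0 ?antisym_alt ?memvZ // => i i_incr.
have := forall4P i check; rewrite [sorted _ _]i_incr => /eqP dual_i.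
rewrite duality_tensor_int !ffunE dual_i intrM.
by rewrite -[LHS]/(_ * _) -[RHS]/(_ * _) mulrA [_^-1 * _]mulrC.
Qed.

End IntegerTensors.

Arguments zalt : simpl never.

(* The entry +-(a + 1) in row i and column j says that gamma_a has the entry    *)
(* +-1 there. The pairs {i, j} on which gamma_a is supported, and the signs up  *)
(* to one sign per a, are read off Theta_ijkl = - (gamma_a)_ij (gamma_a)_kl.    *)
Definition gamma_table : seq (seq int) :=
  [:: [::  0;  1;  2;  3;  4;  5;  6;  7];
      [:: -1;  0; -7; -4;  3;  6; -5;  2];
      [:: -2;  7;  0; -5; -6;  3;  4; -1];
      [:: -3;  4;  5;  0; -1; -2; -7;  6];
      [:: -4; -3;  6;  1;  0;  7; -2; -5];
      [:: -5; -6; -3;  2; -7;  0;  1;  4];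
      [:: -6;  5; -4;  7;  2; -1;  0; -3];
      [:: -7; -2;  1; -6;  5; -4;  3;  0]].

Definition zentry i j : int := nth 0 (nth [::] gamma_table i) j.

Definition zgamma (a i j : nat) : int :=
  if `|zentry i j|%N == a.+1 then sgz (zentry i j) else 0.

(** Distinctness is imposed separately: on an index ijij with i, j different the product of signs is
    not 0. *)
Definition ztheta (l : seq nat) : int :=
  let ij := zentry (nth 0 l 0)%N (nth 0 l 1)%N in
  let kl := zentry (nth 0 l 2)%N (nth 0 l 3)%N in
  if uniq l && (`|ij|%N == `|kl|%N) then - (sgz ij * sgz kl) else 0.

Definition zmul (g h : nat -> nat -> int) (i j : nat) : int :=
  zsum 8 (fun m => if g i m == 0 then 0 else g i m * h m j).

(** * The Spin(7) structure *)

Section Spin7Forms.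
Variable R : numFieldType.

Definition gamma (a : 'I_7) : 'M[R]_8 := int_mx R 8 (zgamma a).

Definition zid (i j : nat) : int := (i == j)%:R.

Lemma int_mx_mul (g h : nat -> nat -> int) :
  int_mx R 8 g *m int_mx R 8 h = int_mx R 8 (zmul g h).
Proof.
apply/matrixP=> i j; rewrite !mxE zsumE; apply: eq_bigr => m _; rewrite !mxE.
by case: eqP => [->|_]; rewrite ?mul0r ?intrM.
Qed.

Lemma int_mx1 : int_mx R 8 zid = 1.
Proof. by apply/matrixP=> i j; rewrite !mxE /zid val_eqE; case: eqP. Qed.

Lemma eq_int_mx (g h : nat -> nat -> int) :
  all (fun i => all (fun j => g i j == h i j) (iota 0 8)) (iota 0 8) ->
  int_mx R 8 g = int_mx R 8 h.
Proof.
move=> gh; apply/matrixP=> i j; rewrite !mxE.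
have in_iota (l : 'I_8) : val l \in iota 0 8 by rewrite mem_iota ltn_ord.
by have /allP/(_ _ (in_iota i))/allP/(_ _ (in_iota j))/eqP -> := gh.
Qed.

(* The table is shared by vm_compute, where g would be re-evaluated at each use. *)
Definition tabulate_mx (g : nat -> nat -> int) : nat -> nat -> int :=
  let t := [seq [seq g i j | j <- iota 0 8] | i <- iota 0 8] in
  fun i j => nth 0 (nth [::] t i) j.

Lemma int_mx_tabulate g : int_mx R 8 (tabulate_mx g) = int_mx R 8 g.
Proof.
apply/matrixP=> i j; rewrite !mxE /tabulate_mx.
by rewrite (nth_map 0%N) ?size_iota // (nth_map 0%N) ?size_iota // !nth_iota.
Qed.

Lemma all_ord7 (P : nat -> bool) (a : 'I_7) : all P (iota 0 7) -> P a.
Proof. by move=> /allP; apply; rewrite mem_iota ltn_ord. Qed.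

Lemma gamma_sq a : gamma a * gamma a = -1.
Proof.
rewrite -int_mx1 -mulmxE int_mx_mul.
have -> : - int_mx R 8 zid = int_mx R 8 (fun i j => - zid i j).
  by apply/matrixP=> i j; rewrite !mxE rmorphN.
apply: eq_int_mx; have check : all (fun a => all (fun i => all (fun j =>
  zmul (zgamma a) (zgamma a) i j == - zid i j) (iota 0 8)) (iota 0 8)) (iota 0 7).
  by vm_compute.
exact: (all_ord7 a check).
Qed.

Lemma gamma_anti a b : a != b -> gamma a * gamma b = - (gamma b * gamma a).
Proof.
rewrite -!mulmxE !int_mx_mul => ab.
have -> : - int_mx R 8 (zmul (zgamma b) (zgamma a))
  = int_mx R 8 (fun i j => - zmul (zgamma b) (zgamma a) i j).
  by apply/matrixP=> i j; rewrite !mxE rmorphN.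
apply: eq_int_mx; have check : all (fun a => all (fun b => (a != b) ==>
  all (fun i => all (fun j => zmul (zgamma a) (zgamma b) i j
    == - zmul (zgamma b) (zgamma a) i j) (iota 0 8)) (iota 0 8)) (iota 0 7)) (iota 0 7).
  by vm_compute.
exact: implyP (all_ord7 b (all_ord7 a check)) ab.
Qed.

Lemma gamma_skew a : (gamma a)^T = - gamma a.
Proof.
have -> : (gamma a)^T = int_mx R 8 (fun i j => zgamma a j i).
  by apply/matrixP=> i j; rewrite !mxE.
have -> : - gamma a = int_mx R 8 (fun i j => - zgamma a i j).
  by apply/matrixP=> i j; rewrite !mxE rmorphN.
apply: eq_int_mx; have check : all (fun a => all (fun i => all (fun j =>
  zgamma a j i == - zgamma a i j) (iota 0 8)) (iota 0 8)) (iota 0 7).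
  by vm_compute.
exact: (all_ord7 a check).
Qed.

Lemma Theta_int_check : forall4 (fun l => if uniq l then ztheta l == foldr (fun q acc =>
  zalt 4 (fun l' => (map S l' == q)%:R) l + acc) 0 Theta_quads else true).
Proof. by vm_compute. Qed.

Lemma Theta_int : Theta R = int_tensor R 8 4 ztheta.
Proof.
apply/ffunP=> i; have [i_uniq|i_nuniq] := boolP (uniq (map val i)); last first.
  rewrite [RHS]ffunE /ztheta (negPf i_nuniq) /= (alt_eq0 _ (Theta_alt R)) ?pnatr_eq0 //.
  by rewrite -(map_inj_uniq val_inj).
have := forall4P i Theta_int_check; rewrite i_uniq => /eqP; rewrite !ffunE => ->.
elim: Theta_quads => [|q r IHr]; first by rewrite big_nil.
rewrite big_cons [foldr _ _ _]/= intrD -IHr.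
congr (_ + _); rewrite zaltE; apply: eq_bigr => s _; congr (_ * _).
by rewrite -map_comp; case: eqP.
Qed.

Definition Theta_form : Lambda R 8 4 := vsproj (alt_space R 8 4) (Theta R).

Lemma val_Theta_form : vsval Theta_form = Theta R.
Proof. exact: vsprojK (Theta_alt R). Qed.

Lemma Theta_square_check : forall4 (fun l => if sorted ltn l
  then zsum 7 (fun a => zwedge (zgamma a) (zgamma a) l) == -24 * ztheta l else true).
Proof. by vm_compute. Qed.

(** This places the four-form in the image of the rotation-invariant identity matrix. *)
Lemma Theta_square : Theta_form = - square_form gamma 1%:M.
Proof.
have two_neq0 : 2 != 0 :> R by rewrite pnatr_eq0.
apply: subvs_inj; rewrite val_Theta_form.
apply: (alt_ext two_neq0 (Theta_alt R) (subvsP _)) => i i_incr.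
have := forall4P i Theta_square_check; rewrite [sorted _ _]i_incr.
move=> /eqP/(congr1 (fun z : int => z%:~R : R)); rewrite zsumE intrM => check_i.
have square1 : square_form gamma 1%:M = \sum_a gamma_wedge gamma a a.
  apply: eq_bigr => a _; rewrite (bigD1 a) //= big1 => [|c ca].
    by rewrite addr0 mxE eqxx scale1r.
  by rewrite mxE eq_sym (negPf ca) scale0r.
rewrite square1 linearN linear_sum Theta_int ffunE [RHS]ffunE sum_ffunE /=.
have wedge_i a : vsval (gamma_wedge gamma a a) i
    = 24^-1 * (zwedge (zgamma a) (zgamma a) (map val i))%:~R.
  by rewrite vsprojK ?antisym_alt // wedge2_int !ffunE.
under eq_bigr do rewrite wedge_i.
by rewrite -mulr_sumr check_i; field.
Qed.

Lemma gamma_mul_Theta x y : x != y -> form_act 4 (gamma x * gamma y) Theta_form = 0.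
Proof.
move=> xy; rewrite -/(rotation gamma 4 x y) Theta_square linearN /=.
have gskew := gamma_skew; have gsq := gamma_sq; have ganti := gamma_anti.
by rewrite rotation_square // rotation_mx1 linear0 oppr0.
Qed.

Lemma gamma_mul_spin7 x y : x != y -> gamma x * gamma y \in spin7 R.
Proof.
move=> xy; apply/andP; split.
  by apply/eqP; apply: gamma_mul_skew => //; [exact: gamma_anti | exact: gamma_skew].
by rewrite -val_Theta_form -form_actE gamma_mul_Theta // linear0.
Qed.

Lemma submodule_stable W : submodule (spin7 R) W ->
  stable (rotation gamma 4) (cut_op gamma 4) W.
Proof.
move=> W_sub x y xy u uW; have KW v : v \in W -> rotation gamma 4 x y v \in W.
  by apply: W_sub; apply: gamma_mul_spin7.
by rewrite cut_opE memvD ?memvZ ?KW.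
Qed.

Local Notation b := (b_Theta R).

Lemma b_Theta_equiv A : A \in spin7 R ->
  forall F, b (form_act 4 A F) = form_act 4 A (b F).
Proof. exact: duality_op_equiv. Qed.

Definition zdual_check (f : seq nat -> int) (c : int) :=
  forall4 (fun l => if sorted ltn l then zdual ztheta f l == c * f l else true).

(** Reduces an eigenvector to an integer computation, with the eigenvalue scaled by 24. *)
Lemma b_Theta_check F f c : vsval F = int_tensor R 8 4 f -> zdual_check f c ->
  F \in passmx.leigenspace b (c%:~R / 24).
Proof.
move=> FE check; apply/leigenspaceP; apply: subvs_inj.
have fA : int_tensor R 8 4 f \in alt_space R 8 4 by rewrite -FE subvsP.
by rewrite duality_opE linearZ /= FE Theta_int (duality_tensor_check fA check).
Qed.

Lemma clifford_leigenspace T g c : gamma_prod gamma T = int_mx R 8 g ->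
  zdual_check (zact g ztheta) c ->
  clifford_form gamma Theta_form T \in passmx.leigenspace b (c%:~R / 24).
Proof.
move=> TE; apply: b_Theta_check.
by rewrite form_actE TE val_Theta_form Theta_int tensor_act_int.
Qed.

Lemma clifford_neq0 T g (l : 4.-tuple 'I_8) : gamma_prod gamma T = int_mx R 8 g ->
  zact g ztheta (map val l) != 0 -> clifford_form gamma Theta_form T != 0.
Proof.
move=> TE; apply: contraNneq => /(congr1 vsval)/ffunP/(_ l).
rewrite form_actE TE val_Theta_form Theta_int tensor_act_int ffunE ffunE.
by move=> /eqP; rewrite intr_eq0.
Qed.

(** The sample subset of size [k] on which eigenvalues and nonvanishing are computed. *)
Definition initial k : {set 'I_7} := [set a : 'I_7 | (a < k)%N].

Lemma card_initial k : (k <= 7)%N -> #|initial k| = k.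
Proof.
by move=> k7; rewrite -sum1dep_card -(big_ord_widen 7 (fun=> 1%N)) // sum1_card card_ord.
Qed.

Lemma gamma_prod0 : gamma_prod gamma (initial 0) = int_mx R 8 zid.
Proof. by rewrite int_mx1 /gamma_prod big1 // => a; rewrite inE. Qed.

Lemma gamma_prod1 : gamma_prod gamma (initial 1) = int_mx R 8 (zgamma 0).
Proof.
rewrite /gamma_prod big_mkcond !big_ord_recl big_ord0 !inE /=.
by rewrite !mulr1.
Qed.

Lemma gamma_prod3 : gamma_prod gamma (initial 3)
  = int_mx R 8 (tabulate_mx (zmul (zgamma 0) (zmul (zgamma 1) (zgamma 2)))).
Proof.
rewrite int_mx_tabulate /gamma_prod big_mkcond !big_ord_recl big_ord0 !inE /=.
by rewrite !mulr1 -!int_mx_mul.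
Qed.

End Spin7Forms.

(** Divided by 24, the constants of this and the next three checks are -4, -2, 0 and 2/3. *)
Lemma duality_check0 : zdual_check (zact zid ztheta) (- 96).
Proof. by vm_compute. Qed.

Lemma duality_check1 : zdual_check (zact (zgamma 0) ztheta) (- 48).
Proof. by vm_compute. Qed.

Lemma duality_check3 :
  zdual_check
  (zact (tabulate_mx (zmul (zgamma 0) (zmul (zgamma 1) (zgamma 2)))) ztheta) 0.
Proof. by vm_compute. Qed.

Lemma duality_check_wedge : zdual_check (zwedge (zgamma 0) (zgamma 1)) 16.
Proof. by vm_compute. Qed.

(** * The four eigenspaces as irreducible modules *)

Section Decomposition.
Variable R : numFieldType.
Local Notation b := (b_Theta R).
Local Notation E := (passmx.leigenspace b).
Local Notation gamma := (@gamma R).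
Local Notation cf := (clifford_form gamma (Theta_form R)).
Local Notation stable := (stable (rotation gamma 4) (cut_op gamma 4)).

Let gsq := @gamma_sq R.
Let ganti := @gamma_anti R.
Let gskew := @gamma_skew R.

Lemma leigenspace_stable a : stable (E a).
Proof. by apply/submodule_stable/leigenspace_submodule; apply: b_Theta_equiv. Qed.

Lemma cut_clifford k x y (T : {set 'I_7}) : x != y -> #|T| = k ->
  cut_op gamma 4 x y (cf T) = (if cuts T x y then - 48 else 0) *: cf T.
Proof. by move=> xy _; apply: cut_op_clifford => //; apply: gamma_mul_Theta. Qed.

Lemma exchange_clifford k x y (T : {set 'I_7}) : #|T| = k -> x \in T -> y \notin T ->
  exists2 d, d != 0 & rotation gamma 4 x y (cf T) = d *: cf (y |: T :\ x).
Proof. by move=> _; apply: rotation_exchange => //; apply: gamma_mul_Theta. Qed.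

Section CliffordModule.
Variables (k : nat) (g : nat -> nat -> int) (c : int) (l : 4.-tuple 'I_8).
Hypothesis k7 : (k <= 7)%N.
Hypothesis prodE : gamma_prod gamma (initial k) = int_mx R 8 g.
Hypothesis check : zdual_check (zact g ztheta) c.
Hypothesis nonzero : zact g ztheta (map val l) != 0.

(** If one form of the family were 0, exchanges would carry this to the sample subset. *)
Lemma clifford_form_neq0 (T : {set 'I_7}) : #|T| = k -> cf T != 0.
Proof.
move=> Tk; apply: contraNneq (clifford_neq0 prodE nonzero) => T0.
have stable0 : stable 0%VS.
  by move=> x y _ u; rewrite memv0 => /eqP->; rewrite !linear0 mem0v.
rewrite -memv0; apply: (mem_family_exchange (@exchange_clifford k) stable0 Tk).
  exact: card_initial.
by rewrite T0 mem0v.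
Qed.

Lemma dim_clifford : \dim (family_span k cf) = 'C(7, k).
Proof.
apply: (dim_family_span (rotation gamma 4) (natr_neg48_neq0 R) _ (@cut_clifford k)).
  (* 7 is odd, so it is not k + k. *)
  by apply/eqP => /(congr1 odd); rewrite oddD addbb.
exact: clifford_form_neq0.
Qed.

(** The eigenspace is stable, so one sample vector brings in the whole family. *)
Lemma clifford_sub_leigenspace : (family_span k cf <= E (c%:~R / 24))%VS.
Proof.
apply: (family_span_sub (@exchange_clifford k) (@leigenspace_stable _)
  (card_initial k7)).
exact: clifford_leigenspace prodE check.
Qed.

(** Invariance under all of spin(7) is a premise here: it comes from the identification with an
    eigenspace, while minimality uses only the products of two gammas. *)
Lemma clifford_irreducible : submodule (spin7 R) (family_span k cf) ->
  irreducible (spin7 R) (family_span k cf).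
Proof.
move=> U_sub; split=> // [|W W_sub WU].
  by rewrite -dimv_eq0 dim_clifford -lt0n bin_gt0.
have [->|W_neq0] := eqVneq W 0%VS; [by left | right].
apply: (family_span_minimal (natr_neg48_neq0 R) _ (@cut_clifford k)
  (@exchange_clifford k) (submodule_stable W_sub) WU W_neq0).
by apply/eqP => /(congr1 odd); rewrite oddD addbb.
Qed.

End CliffordModule.

Lemma wedge_int : vsval (24 *: gamma_wedge gamma 0 1)
  = int_tensor R 8 4 (zwedge (zgamma 0) (zgamma 1)).
Proof.
rewrite linearZ /= vsprojK ?antisym_alt // wedge2_int scalerA divff ?scale1r //.
by rewrite pnatr_eq0.
Qed.

Lemma gamma_wedgeC x y : gamma_wedge gamma x y = gamma_wedge gamma y x.
Proof. by rewrite /gamma_wedge wedge2C. Qed.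

Lemma square_form_delta x y : square_form gamma (delta_mx x y) = gamma_wedge gamma x y.
Proof.
rewrite /square_form (bigD1 x) //= [X in _ + X]big1 => [|a /negPf ax]; last first.
  by rewrite big1 // => a' _; rewrite mxE ax scale0r.
rewrite addr0 (bigD1 y) //= big1 => [|a /negPf ay]; last by rewrite mxE ay andbF scale0r.
by rewrite mxE !eqxx scale1r addr0.
Qed.

Lemma pair_wedge : pair_form gamma [set 0; 1] = (2 / 24) *: (24 *: gamma_wedge gamma 0 1).
Proof.
rewrite /pair_form pair_mx2 // linearD /= !square_form_delta [X in _ + X]gamma_wedgeC.
by rewrite scalerA mulfVK ?pnatr_eq0 // scaler_nat mulr2n.
Qed.

Lemma pair_leigenspace : pair_form gamma [set 0; 1] \in E (2 / 3).
Proof.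
rewrite (_ : 2 / 3 = 16%:~R / 24) => [|]; last by field.
by rewrite pair_wedge memvZ // (b_Theta_check wedge_int duality_check_wedge).
Qed.

Lemma pair_neq0 : pair_form gamma [set 0; 1] != 0.
Proof.
rewrite pair_wedge scaler_eq0 negb_or mulf_neq0 ?invr_eq0 ?pnatr_eq0 //=.
(* [gamma 0] is supported on the pair {0, 1} and [gamma 1] on {3, 5}. *)
pose l : 4.-tuple 'I_8 := [tuple 0; 1; 3; 5].
apply: contraNneq (_ : zwedge (zgamma 0) (zgamma 1) (map val l) != 0); last by vm_compute.
move=> /(congr1 vsval)/ffunP/(_ l); rewrite wedge_int ffunE ffunE => /eqP.
by rewrite intr_eq0.
Qed.

Lemma square_sub_leigenspace : (square_span gamma <= E (2 / 3))%VS.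
Proof.
apply: (square_span_sub gsq ganti gskew _ (@leigenspace_stable _) _ pair_leigenspace) => //.
by rewrite cards2.
Qed.

(** The count is 49 - 21 - 1 = 27. *)
Lemma dim_square_span_ge : (27 <= \dim (square_span gamma))%N.
Proof.
rewrite (dim_square_span_traceless gsq ganti gskew) //; last first.
  by exists [set 0; 1]; [rewrite cards2 | exact: pair_neq0].
by have := dim_traceless_sym R 7; rewrite (_ : 7 * 7 = 27 + 'C(7, 2).+1)%N // leq_add2r.
Qed.

Lemma square_irreducible : submodule (spin7 R) (square_span gamma) ->
  irreducible (spin7 R) (square_span gamma).
Proof.
move=> U_sub; split=> // [|W W_sub WU].
  by rewrite -dimv_eq0 -lt0n (leq_trans _ dim_square_span_ge).
have W_stable := submodule_stable W_sub.
have [->|W_neq0] := eqVneq W 0%VS; [by left | right].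
apply/eqP; rewrite eqEsubv WU /=.
have /(subvP WU)/memv_imgP[S /traceless_symP[S_sym trS] def_w] := memv_pick W.
rewrite lfunE /= in def_w.
have S_neq0 : S != 0.
  by apply: contraNneq W_neq0 => S0; rewrite -vpick0 def_w S0 linear0.
have SW : square_form gamma S \in W by rewrite -def_w memv_pick.
have [T T2 TW] := pair_form_mem_traceless gsq ganti gskew isT isT W_stable S_sym trS S_neq0 SW.
exact: (square_span_sub gsq ganti gskew isT W_stable T2 TW).
Qed.

Lemma dim_Lambda_le : (dim (Lambda R 8 4) <= 70)%N.
Proof.
by apply: (dim_alt_space_le (R := R) 8 4); rewrite pnatr_eq0.
Qed.

Definition eigenvalues : seq R := [:: 0; - 4; - 2; 2 / 3].

Definition irreducibles : seq {vspace Lambda R 8 4} :=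
  [:: family_span 3 cf; family_span 0 cf; family_span 1 cf; square_span gamma].

Lemma eigenvalues_uniq : uniq eigenvalues.
Proof.
(* Multiplied by 24 the eigenvalues are integers, whose distinctness is computed. *)
have -> : eigenvalues = [seq z%:~R / 24 | z : int <- [:: 0; - 96; - 48; 16]].
  by rewrite /eigenvalues /=; congr [:: _; _; _; _]; field.
rewrite map_inj_uniq // => x y /(mulIf _)/intr_inj; apply.
by rewrite invr_eq0 pnatr_eq0.
Qed.

Lemma eigenvalue_inj : injective (fun j : 'I_4 => nth 0 eigenvalues j).
Proof. by move=> i j /eqP; rewrite nth_uniq ?eigenvalues_uniq // => /eqP/val_inj. Qed.

Lemma irreducibles_sub (j : 'I_4) :
  (nth 0 irreducibles j <= E (nth 0%R eigenvalues j))%VS.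
Proof.
case: j => -[|[|[|[|//]]]] ? /=.
- have := clifford_sub_leigenspace (isT : 3 <= 7)%N (gamma_prod3 R) duality_check3.
  by rewrite mul0r.
- rewrite (_ : - 4 = (- 96)%:~R / 24); last by field.
  exact: clifford_sub_leigenspace (isT : 0 <= 7)%N (gamma_prod0 R) duality_check0.
- rewrite (_ : - 2 = (- 48)%:~R / 24); last by field.
  exact: clifford_sub_leigenspace (isT : 1 <= 7)%N (gamma_prod1 R) duality_check1.
- exact: square_sub_leigenspace.
Qed.

Lemma dim_clifford3 : \dim (family_span 3 cf) = 35%N.
Proof.
(* [l] is an index at which the sample form does not vanish. *)
by rewrite (dim_clifford (l := [tuple 0; 1; 2; 3]) (isT : 3 <= 7)%N (gamma_prod3 R)).
Qed.

Lemma dim_clifford0 : \dim (family_span 0 cf) = 1%N.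
Proof.
by rewrite (dim_clifford (l := [tuple 0; 1; 2; 7]) (isT : 0 <= 7)%N (gamma_prod0 R)).
Qed.

Lemma dim_clifford1 : \dim (family_span 1 cf) = 7%N.
Proof.
by rewrite (dim_clifford (l := [tuple 0; 2; 3; 6]) (isT : 1 <= 7)%N (gamma_prod1 R)).
Qed.

Let a (j : 'I_4) : R := nth 0 eigenvalues j.
Let U (j : 'I_4) : {vspace Lambda R 8 4} := nth 0%VS irreducibles j.

(** The modules found have total dimension at least 35 + 1 + 7 + 27 = 70, the upper bound for the
    whole space, so they exhaust the eigenspaces. *)
Lemma leigenspace_irreducibles :
  (forall j, E (a j) = U j) /\ (\sum_j E (a j))%VS = fullv.
Proof.
apply: leigenspace_full; first exact: eigenvalue_inj.
  exact: irreducibles_sub.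
apply: leq_trans dim_Lambda_le _; rewrite !big_ord_recl big_ord0 /= addn0.
rewrite dim_clifford0 dim_clifford1 dim_clifford3.
by rewrite (leq_add2l 35 35) (leq_add2l 1 34) (leq_add2l 7 27) dim_square_span_ge.
Qed.

Lemma dim_square_span : \dim (square_span gamma) = 27%N.
Proof.
have [EU full] := leigenspace_irreducibles.
have /directvP/= := directv_leigenspace b eigenvalue_inj.
rewrite full dimvf; under eq_bigr do rewrite EU.
rewrite !big_ord_recl big_ord0 /= addn0 dim_clifford0 dim_clifford1 dim_clifford3.
move=> dimE; apply/eqP; rewrite eqn_leq dim_square_span_ge andbT.
by have := dim_Lambda_le; rewrite dimE (leq_add2l 35 _ 35) (leq_add2l 1 _ 34) (leq_add2l 7 _ 27).
Qed.

Lemma dim_irreducibles (j : 'I_4) : \dim (U j) = nth 0%N [:: 35; 1; 7; 27]%N j.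
Proof.
case: j => -[|[|[|[|//]]]] ? /=; rewrite /U /=.
- exact: dim_clifford3.
- exact: dim_clifford0.
- exact: dim_clifford1.
- exact: dim_square_span.
Qed.

(** Each eigenspace is a submodule by equivariance, which supplies the premise of the irreducibility
    lemmas. *)
Lemma irreducible_leigenspace (j : 'I_4) : irreducible (spin7 R) (E (a j)).
Proof.
have [EU _] := leigenspace_irreducibles.
have : submodule (spin7 R) (E (a j)).
  by apply: leigenspace_submodule; apply: b_Theta_equiv.
rewrite EU; case: j => -[|[|[|[|//]]]] ?; rewrite /U /=.
- exact: (clifford_irreducible (l := [tuple 0; 1; 2; 3]) (isT : 3 <= 7)%N (gamma_prod3 R)).
- exact: (clifford_irreducible (l := [tuple 0; 1; 2; 7]) (isT : 0 <= 7)%N (gamma_prod0 R)).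
- exact: (clifford_irreducible (l := [tuple 0; 2; 3; 6]) (isT : 1 <= 7)%N (gamma_prod1 R)).
- exact: square_irreducible.
Qed.

Lemma the_irreducible_leigenspace (j : 'I_4) :
  the_irreducible (spin7 R) (nth 0%N [:: 35; 1; 7; 27]%N j) (E (a j)).
Proof.
have [EU full] := leigenspace_irreducibles.
rewrite -dim_irreducibles -EU; apply: the_irreducible_eigenspace.
- exact: b_Theta_equiv.
- exact: eigenvalue_inj.
- exact: full.
- exact: irreducible_leigenspace.
- by move=> i l /eqP; rewrite !EU !dim_irreducibles nth_uniq // => /eqP/val_inj.
Qed.

Lemma leigenspace_decomposition : decomposition (spin7 R) (fun j => E (a j)).
Proof.
have [_ full] := leigenspace_irreducibles.
split; [exact: irreducible_leigenspace | | exact: full].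
exact: directv_leigenspace eigenvalue_inj.
Qed.

Lemma leigenspace_neq0 (j : 'I_4) : E (a j) != 0%VS.
Proof. by have [_] := irreducible_leigenspace j. Qed.

Lemma b_Theta_has_order : has_order b 4.
Proof.
exists eigenvalues; split=> // [|x]; first exact: eigenvalues_uniq.
have [_ full] := leigenspace_irreducibles.
rewrite (leigenvalueE full leigenspace_neq0).
apply/codomP/idP => [[j ->]|/(nthP 0)[j j4 <-]]; first by rewrite mem_nth.
by exists (Ordinal j4).
Qed.

Lemma b_Theta_minimal_poly :
  is_minimal_poly b ('X * ('X + 2%:P) * ('X + 4%:P) * ('X - (2 / 3)%:P)).
Proof.
have [_ full] := leigenspace_irreducibles.
have := is_minimal_poly_prod eigenvalue_inj full leigenspace_neq0.
suff -> : \prod_(j < 4) ('X - (a j)%:P)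
  = 'X * ('X + 2%:P) * ('X + 4%:P) * ('X - (2 / 3)%:P) by [].
rewrite !big_ord_recl big_ord0 /a /= subr0 !polyCN !opprK mulr1 -!mulrA.
by congr (_ * _); rewrite mulrCA.
Qed.

Lemma minimal_poly_expand :
  'X * ('X + 2%:P) * ('X + 4%:P) * ('X - (2 / 3)%:P)
    = 'X^4 + (16 / 3) *: 'X^3 + 4 *: 'X^2 - (16 / 3) *: 'X :> {poly R}.
Proof.
(* The constant 2/3 becomes a variable [c] with 3 c = 2, so that the identity lives in a commutative
   ring without division. *)
have c3 : (2 / 3)%:P * 3 - 2 = 0 :> {poly R}.
  by rewrite -!polyC_natr -polyCM divfK ?pnatr_eq0 // subrr.
have c16 : (16 / 3)%:P = 8 * (2 / 3)%:P :> {poly R}.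
  by rewrite -[8]polyC_natr -polyCM mulrA -natrM.
rewrite -!mul_polyC c16 !polyC_natr; move: (2 / 3)%:P c3 => c c3.
apply/eqP; rewrite -subr_eq0; apply/eqP.
(* The two sides differ by (3 c - 2) times - (3 X^3 + 2 X^2). *)
by rewrite -[RHS](mul0r (- (3 * 'X^3 + 2 * 'X^2))) -c3; ring.
Qed.

End Decomposition.

Theorem proposition3p5 (R : realType) :
  let b : 'End(Lambda R 8 4) := b_Theta R in
  [/\ (* the components of b *)
      forall (F : Lambda R 8 4) (i : 4.-tuple 'I_8),
        vsval (b F) i =
          \sum_(j : 4.-tuple 'I_8) duality_coef (Theta R) i j * vsval F j,
      (* b is a perfect duality operator of order four *)
      perfect (spin7 R) (Theta R) /\ has_order b 4,
      (* the eigenspaces are the irreducible submodules of Lambda^4 V *)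
      [/\ the_irreducible (spin7 R) 35 (passmx.leigenspace b 0),
          the_irreducible (spin7 R) 1 (passmx.leigenspace b (- 4)),
          the_irreducible (spin7 R) 7 (passmx.leigenspace b (- 2)),
          the_irreducible (spin7 R) 27 (passmx.leigenspace b (2 / 3))
        & decomposition (spin7 R)
            (fun j : 'I_4 => passmx.leigenspace b (nth 0 [:: 0; - 4; - 2; 2 / 3] j))]
    & (* the minimal polynomial *)
      is_minimal_poly b
        ('X * ('X + 2%:P) * ('X + 4%:P) * ('X - (2 / 3)%:P)) /\
      'X * ('X + 2%:P) * ('X + 4%:P) * ('X - (2 / 3)%:P)
        = 'X^4 + (16 / 3) *: 'X^3 + 4 *: 'X^2 - (16 / 3) *: 'X
        :> {poly R}].
Proof.
move=> b; split.
- move=> F i; rewrite duality_opE; apply: duality_tensorE.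
  + by rewrite pnatr_eq0.
  + by rewrite pnatr_eq0.
  + exact: Theta_alt.
  + exact: subvsP.
- split; last exact: b_Theta_has_order.
  split=> [A /andP[]//|A /andP[_ /eqP]//|].
  exists 4%N; split; first exact: b_Theta_has_order.
  by exists (fun j : 'I_4 => passmx.leigenspace b (nth 0 (eigenvalues R) j));
    apply: leigenspace_decomposition.
- split; last exact: leigenspace_decomposition.
  + exact: (the_irreducible_leigenspace R (Ordinal (isT : 0 < 4)%N)).
  + exact: (the_irreducible_leigenspace R (Ordinal (isT : 1 < 4)%N)).
  + exact: (the_irreducible_leigenspace R (Ordinal (isT : 2 < 4)%N)).
  + exact: (the_irreducible_leigenspace R (Ordinal (isT : 3 < 4)%N)).
- by split; [exact: b_Theta_minimal_poly | exact: minimal_poly_expand].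
Qed.
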